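(* Let $p\neq 2$ be a prime, let $K$ be a complete non-Archimedean valued field which is an extension of $\mathbb Q_p$ and whose absolute value extends the $p$-adic absolute value, and let $\mathcal B$ be a Banach space over $K$. Let $W(z)$, $z\in\mathbb Z_p$, be a norm continuous unitary representation of the additive group $\mathbb Z_p$ on $\mathcal B$, such that the spectrum of the operator $W(p^{-1}\log(1+p))-I$ lies in $p\mathbb Z_p$, where $\log$ is the $p$-adic logarithm. Then there exists a strongly normal operator $A$ on $\mathcal B$ with $\sigma(A)\subseteq\mathbb Z_p$ such that $W(z)=e^{pzA}$ for all $z\in\mathbb Z_p$.
   Context: Let $L(\mathcal B)$ be the algebra of bounded linear operators on $\mathcal B$ with the operator norm, and $I$ the identity operator. For $A\in L(\mathcal B)$, $\sigma(A)$ denotes the spectrum of $A$, and $\mathcal L_A$ denotes the commutative Banach algebra generated by $A$ and $I$, i.e. the operator-norm closure in $L(\mathcal B)$ of the algebra $K[A]$ of polynomials in $A$. $\mathcal M(\mathcal L_A)$ denotes the Berkovich spectrum of $\mathcal L_A$: the set of all bounded multiplicative seminorms on $\mathcal L_A$, with its natural topology (the weakest one making all maps $x\mapsto |T|_x$, $T\in\mathcal L_A$, continuous); it is a nonempty compact Hausdorff space. Normal operator: $A$ is called normal if $\mathcal L_A$ is uniform, that is $\|T^2\|=\|T\|^2$ for all $T\in\mathcal L_A$, and all characters of $\mathcal L_A$ take values in $K$. Then $\mathcal M(\mathcal L_A)$ is totally disconnected and $\mathcal L_A$ is isometrically isomorphic to the algebra $C(\mathcal M(\mathcal L_A),K)$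 of continuous $K$-valued functions with the supremum norm; the characteristic function of an open-closed set $\Lambda\subset\mathcal M(\mathcal L_A)$ corresponds to an idempotent operator $E(\Lambda)=E_A(\Lambda)\in\mathcal L_A$, and these form a finitely additive, norm-bounded projection-valued measure. Strongly normal operator: a normal operator $A$ is called strongly normal if its spectrum $\sigma(A)$ is a nonempty totally disconnected compact subset of $K$ and $\mathcal M(\mathcal L_A)=\sigma(A)$. Under this identification $\mathcal L_A\cong C(\sigma(A),K)$ isometrically, with $A$ corresponding to the function $\lambda\mapsto\lambda$. For a continuous function $\varphi:\sigma(A)\to K$, the operator $\varphi(A)=\int_{\sigma(A)}\varphi(\lambda)\,E_A(d\lambda)\in\mathcal L_A$ is the one corresponding to $\varphi$ under this isomorphism. Unitary operator: an operator $U$ on $\mathcal B$ is called unitary if $U=I+V$ where $V$ is strongly normal and $\|V\|<1$. Norm continuous unitary representation of $\mathbb Z_p$: a family of unitary operators $W(z)$, $z\in\mathbb Z_p$, on $\mathcal B$ such that $W(z_1+z_2)=W(z_1)W(z_2)$ for all $z_1,z_2\in\mathbb Z_p$, and $z\mapsto W(z)$ is continuous with respect to the operator norm. Note that $p^{-1}\log(1+p)\in\mathbb Z_p$. For a strongly normal operator $A$ with $\sigma(A)\subseteq\mathbb Z_p$ and $z\in\mathbb Z_p$, $e^{pzA}=\varphi(A)$ with $\varphi(\lambda)=e^{pz\lambda}$, where $e^x=\sum_{n\ge 0}x^n/n!$ is the $p$-adic exponential (convergent on $p\mathbb Z_p$ since $p\ne 2$). *)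

(* Defs.v *)
From HB Require Import structures.
From mathcomp Require Import all_boot all_order all_algebra.
From mathcomp Require Import all_classical all_reals all_analysis.

Set Implicit Arguments.
Unset Strict Implicit.
Unset Printing Implicit Defensive.
Import Order.TTheory GRing.Theory Num.Theory.
Import numFieldTopology.Exports.
Local Open Scope classical_set_scope.
Local Open Scope ring_scope.

(* The library's normedZmodType cannot be used for an ultrametric norm, since it
   requires `|x *+ n| = `|x| *+ n. *)

Definition norm_complete (R : realType) (V : zmodType) (N : V -> R) : Prop :=
  forall u : nat -> V,
    (forall e : R, 0 < e ->
       exists n0, forall m n, (n0 <= m)%N -> (n0 <= n)%N -> N (u m - u n) < e) ->
  exists l : V,
    forall e : R, 0 < e -> exists n0, forall n, (n0 <= n)%N -> N (u n - l) < e.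

HB.mixin Record Field_isNonArchValued (R : realType) K of GRing.Field K := {
  vabs : K -> R ;
  vabs_ge0 : forall x, 0 <= vabs x ;
  vabs_eq0 : forall x, (vabs x == 0) = (x == 0) ;
  vabsM : forall x y, vabs (x * y) = vabs x * vabs y ;
  vabs_ultra : forall x y, vabs (x + y) <= Num.max (vabs x) (vabs y) ;
  vabs_complete : norm_complete vabs
}.

#[short(type="nonArchFieldType")]
HB.structure Definition NonArchField (R : realType) :=
  {K of GRing.Field K & Field_isNonArchValued R K}.

HB.mixin Record Lmodule_isNonArchBanach (R : realType) (K : nonArchFieldType R) B
    of GRing.Lmodule K B := {
  vnorm : B -> R ;
  vnorm_ge0 : forall x, 0 <= vnorm x ;
  vnorm_eq0 : forall x, (vnorm x == 0) = (x == 0) ;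
  vnormZ : forall (k : K) x, vnorm (k *: x) = vabs k * vnorm x ;
  vnorm_ultra : forall x y, vnorm (x + y) <= Num.max (vnorm x) (vnorm y) ;
  vnorm_complete : norm_complete vnorm
}.

#[short(type="nonArchBanachType")]
HB.structure Definition NonArchBanach (R : realType) (K : nonArchFieldType R) :=
  {B of GRing.Lmodule K B & Lmodule_isNonArchBanach R K B}.

Section Metric.
Variables (R : realType) (K : nonArchFieldType R).
Implicit Types x y z : K.

Let dist x y : R := vabs (x - y).

Let distxx x : dist x x = 0.
Proof. by apply/eqP; rewrite /dist subrr vabs_eq0. Qed.

Let dist_positivity x y : dist x y = 0 -> x = y.
Proof. by move/eqP; rewrite vabs_eq0 subr_eq0 => /eqP. Qed.

Lemma vabs1 : vabs (1 : K) = 1.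
Proof.
have h : vabs (1 : K) != 0 by rewrite vabs_eq0 oner_eq0.
by apply: (mulIf h); rewrite -vabsM !mul1r.
Qed.

Lemma vabsN x : vabs (- x) = vabs x.
Proof.
have h : vabs (-1 : K) = 1.
  apply/eqP; rewrite -(@pexpr_eq1 _ _ 2) ?vabs_ge0//.
  by rewrite expr2 -vabsM mulrNN mulr1 vabs1.
by rewrite -mulN1r vabsM h mul1r.
Qed.

Let dist_sym x y : dist x y = dist y x.
Proof. by rewrite /dist -opprB vabsN. Qed.

Let dist_triangle y x z : dist x z <= dist x y + dist y z.
Proof.
rewrite /dist -(subrKA y) (le_trans (vabs_ultra _ _))// ge_max.
by rewrite lerDl lerDr !vabs_ge0.
Qed.

HB.instance Definition _ := isMetric.Build R (NonArchField.sort K)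
  distxx dist_positivity dist_sym dist_triangle.

HB.instance Definition _ := isPointed.Build (NonArchField.sort K) 0.

End Metric.

Section Padic.
Variable R : realType.

(* p ^ (- v_p(q)), where v_p(q) = v_p(numerator) - v_p(denominator) *)
Definition padic_abs (p : nat) (q : rat) : R :=
  if q == 0 then 0
  else p%:R ^ ((logn p `|denq q|%N)%:Z - (logn p `|numq q|%N)%:Z).

Variable K : nonArchFieldType R.

(* When vabs restricts to the p-adic absolute value on the rationals, the
   closure of the prime field in the complete field K is its completion,
   namely the field of p-adic numbers. *)
Definition padic_num : set K := closure (range (@ratr K)).

Definition padic_int : set K := [set x | padic_num x /\ vabs x <= 1].

Definition plog (y : K) : K :=
  limn (series (fun n : nat => (-1) ^+ n * (y - 1) ^+ n.+1 / n.+1%:R)).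

Definition pexp (x : K) : K :=
  limn (series (fun n : nat => x ^+ n / n`!%:R)).

End Padic.
Arguments padic_num {R} K.
Arguments padic_int {R} K.

Section Operators.
Variables (R : realType) (K : nonArchFieldType R) (B : nonArchBanachType K).
Implicit Types (A T U V : B -> B) (L : set (B -> B)).

Definition bounded_op T : Prop :=
  linear T /\ exists C : R, forall x, vnorm (T x) <= C * vnorm x.

(* The value at x = 0 is 0 / 0 = 0, which does not affect the supremum. *)
Definition opnorm T : R := sup (range (fun x => vnorm (T x) / vnorm x)).

Definition spectrum A : set K :=
  [set l | ~ exists T, [/\ bounded_op T, T \o (A - l *: idfun) = idfun
                         & (A - l *: idfun) \o T = idfun]].

Definition poly_op (q : {poly K}) A : B -> B :=
  fun x => \sum_(i < size q) q`_i *: iter i A x.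

(* the Banach algebra generated by A and the identity *)
Definition gen_alg A : set (B -> B) :=
  [set T | bounded_op T /\
    forall e : R, 0 < e -> exists q : {poly K}, opnorm (T - poly_op q A) < e].

(* In the next definitions L is a unital subalgebra of the bounded operators,
   viewed as a type through the coercion of sets to types. *)

Record mult_seminorm L (x : L -> R) : Prop := MultSeminorm {
  msn_ge0 : forall T : L, 0 <= x T ;
  msn0 : forall T : L, val T = 0 -> x T = 0 ;
  msn1 : forall T : L, val T = idfun -> x T = 1 ;
  msnB : forall S T U : L, val U = val S - val T -> x U <= x S + x T ;
  msnM : forall S T U : L, val U = val S \o val T -> x U = x S * x T ;
  msn_bounded : exists C : R, forall T : L, x T <= C * opnorm (val T)
}.

(* A subset of the product space: pointwise convergence is the weakest topology
   making all the maps x |-> x T continuous. *)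
Definition berkovich L : set {ptws L -> R} := [set x | mult_seminorm x].
Arguments berkovich : clear implicits.

Record character L (F : nonArchFieldType R) (i : K -> F) (chi : L -> F) : Prop :=
  Character {
  chr1 : forall T : L, val T = idfun -> chi T = 1 ;
  chrD : forall S T U : L, val U = val S + val T -> chi U = chi S + chi T ;
  chrM : forall S T U : L, val U = val S \o val T -> chi U = chi S * chi T ;
  chrZ : forall (k : K) (S T : L), val T = k *: val S -> chi T = i k * chi S ;
  chr_bounded : exists C : R, forall T : L, vabs (chi T) <= C * opnorm (val T)
}.

Definition uniform_alg L : Prop :=
  forall T, L T -> opnorm (T \o T) = opnorm T ^+ 2.

Definition characters_in_base L : Prop :=
  forall (F : nonArchFieldType R) (i : {rmorphism K -> F}),
    (forall k, vabs (i k) = vabs k) ->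
  forall chi : L -> F, character i chi -> forall T : L, exists k : K, chi T = i k.

Definition normal_op A : Prop :=
  [/\ bounded_op A, uniform_alg (gen_alg A) & characters_in_base (gen_alg A)].

(* The Gelfand transform of T takes the value k at the point x: for a K-valued
   character chi with x = |chi|, this says chi(T) = k. *)
Definition gelfand_value L (x : L -> R) T (k : K) : Prop :=
  exists2 D : L, val D = T - k *: idfun & x D = 0.

Definition homeo_on (X Y : topologicalType) (M : set X) (N : set Y) (h : X -> Y) :=
  [/\ set_bij M N h, {within M, continuous h}
    & exists2 g : Y -> X, {in M, cancel h g} & {within N, continuous g}].

(* The identification of M(L_A) with the spectrum is the canonical one, under
   which A itself becomes the function l |-> l. *)
Definition strongly_normal A : Prop :=
  [/\ normal_op A,
      spectrum A !=set0,
      compact (spectrum A),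
      totally_disconnected (spectrum A)
    & exists h : {ptws gen_alg A -> R} -> K,
        homeo_on (berkovich (gen_alg A)) (spectrum A) h /\
        forall x, berkovich (gen_alg A) x -> gelfand_value x A (h x)].

(* phi(A): the operator of L_A whose Gelfand transform is phi, that is, takes
   the value phi(l) at the point of M(L_A) identified with l.  For A strongly
   normal and phi continuous on the spectrum of A there is exactly one. *)
Definition fun_calc A (phi : K -> K) : B -> B :=
  xget 0 [set T | gen_alg A T /\
    forall x l, berkovich (gen_alg A) x ->
      gelfand_value x A l -> gelfand_value x T (phi l)].

Definition unitary_op U : Prop :=
  exists V, [/\ U = idfun + V, strongly_normal V & opnorm V < 1].

(* Only the values of W on the p-adic integers matter. *)
Definition unitary_rep (W : K -> B -> B) : Prop :=
  [/\ forall z, padic_int K z -> unitary_op (W z),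
      forall z1 z2, padic_int K z1 -> padic_int K z2 -> W (z1 + z2) = W z1 \o W z2
    & forall z0, padic_int K z0 ->
        opnorm (W z - W z0) @[z --> within (padic_int K) (nbhs z0)] --> (0 : R)].

End Operators.
Arguments berkovich {R K B} L.

(* Main.v *)
From HB Require Import structures.
Require Import Defs.
From mathcomp Require Import all_boot all_order all_algebra.
From mathcomp Require Import all_classical all_reals all_analysis.
From mathcomp Require Import ring lra zify.

Set Implicit Arguments.
Unset Strict Implicit.
Unset Printing Implicit Defensive.
Import Order.TTheory GRing.Theory Num.Theory.
Import numFieldNormedType.Exports.
Local Open Scope classical_set_scope.
Local Open Scope ring_scope.

(** Write [c] for [p%:R^-1 * plog (1 + p%:R)] and [W c = I + V], with [V]
strongly normal and its spectrum in [p Z_p].  If [W z = e^(pzA)] then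
[I + V = e^(pcA)], so [A] has to be [(pc)^-1] times a logarithm of [I + V].  Of
the number [c] it only matters that it is a unit of [Z_p] (lemma [plog_unit]).

No logarithm of operators is used.  In a complete commutative ultrametric
algebra over [K] the exponential converges on the ball of radius [|p|], and
there its difference quotients are perturbations of [1] by elements of norm at
most [|p|^(1/2) < 1] (lemma [alg_exp_factor]; this is where [p] is odd).  Hence
[e^x - 1 - x] is a contraction, and a fixed point argument inverts the
exponential between that ball and its translate by [1] (lemma [alg_exp_onto]).
This is applied in the field of p-adic numbers inside [K], and in the algebra
generated by [V], where it gives [pcA] with [e^(pcA) = I + V].

As [V] is an exponential series in [A], and [A] lies in the algebra of [V], the
two operators generate the same algebra (lemma [gen_alg_generator]); so
uniformity, the characters and the Berkovich spectrum of [A] are those of [V].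
The factorization [e^x - e^y = (x - y) g] with [g] invertible, applied to
[x = pcA] and to the scalar [y = pcl], shows that [A - l] is invertible exactly
when [V - (e^(pcl) - 1)] is, and that they vanish at the same points of the
Berkovich spectrum.  So [l |-> e^(pcl) - 1], which multiplies distances by
[|p|], is a bijection of [spectrum A] onto [spectrum V], and strong normality
passes from [V] to [A] (lemma [generator_strongly_normal]).  The same bijection
between p-adic numbers puts [spectrum A] in [Z_p].

For a positive integer [n], [W (nc) = (I + V)^n = e^(pncA)].  The multiples
[nc] are dense in [Z_p], and both sides of [W z = e^(pzA)] are continuous in
[z] (lemma [rep_generator]).  The factorization once more shows that the
operator [e^(pzA)] takes the value [e^(pzl)] where [A] takes the value [l].

Two steps need that elements of the algebra are controlled by their values on
the Berkovich spectrum: the bound [|p|] on the norm of [V], which brings [V]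
into the range of the exponential, and the uniqueness of an operator with given
values.  Both follow from the fact that the norm of a uniform algebra is
attained, at each element, by a bounded multiplicative seminorm (theorem
[uniform_norm_attained]). *)

(** * Multiplicative seminorms below a uniform seminorm *)

Record uniform_seminorm (R : realType) (A : comPzRingType) (N : A -> R) : Prop :=
  UniformSeminorm {
  usn_ge0 : forall x, 0 <= N x ;
  usn0 : N 0 = 0 ;
  usn1 : N 1 = 1 ;
  usnB : forall x y, N (x - y) <= N x + N y ;
  usnM : forall x y, N (x * y) <= N x * N y ;
  usn_sqr : forall x, N (x * x) = N x ^+ 2
}.

Section UniformSeminorm.
Variables (R : realType) (A : comPzRingType).
Implicit Types (N : A -> R) (f g h x y : A).

Lemma usnX N : uniform_seminorm N -> forall x n, N (x ^+ n) = N x ^+ n.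
Proof.
move=> uN x.
have le n : N (x ^+ n) <= N x ^+ n.
  elim: n => [|n IH]; first by rewrite !expr0 (usn1 uN).
  rewrite !exprS (le_trans (usnM uN _ _))//.
  by rewrite ler_wpM2l// (usn_ge0 uN).
have pow2 k : N (x ^+ (2 ^ k)) = N x ^+ (2 ^ k).
  elim: k => [|k IH]; first by rewrite expn0 !expr1.
  by rewrite expnS mulnC !exprM -IH expr2 (usn_sqr uN).
move=> n; apply/eqP; rewrite eq_le le/=.
have [Nx0|Nx0] := eqVneq (N x) 0.
  case: n => [|n]; first by rewrite !expr0 (usn1 uN).
  by rewrite Nx0 expr0n (usn_ge0 uN).
have Nxp : 0 < N x by rewrite lt_def Nx0 (usn_ge0 uN).
have n2 : (n <= 2 ^ n)%N by apply: ltnW; exact: ltn_expl.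
rewrite -(ler_pM2r (exprn_gt0 (2 ^ n - n) Nxp)) -exprD subnKC// -pow2.
rewrite -{1}(subnKC n2) exprD (le_trans (usnM uN _ _))//.
by rewrite ler_wpM2l ?(usn_ge0 uN).
Qed.

(** The largest seminorm below [N] that multiplication by [g] scales by [N g]. *)
Definition localized N g h : R := limn (fun n => N (g ^+ n * h) / N g ^+ n).

Section Localized.
Variables (N : A -> R) (g : A).
Hypotheses (uN : uniform_seminorm N) (g_gt0 : 0 < N g).

Let a h n := N (g ^+ n * h) / N g ^+ n.

Let a_ge0 h n : 0 <= a h n.
Proof. by rewrite divr_ge0 ?exprn_ge0 ?(usn_ge0 uN). Qed.

Let a_dec h : {homo a h : m n / (m <= n)%N >-> n <= m}.
Proof.
apply/nonincreasing_seqP => n; rewrite /a ler_pdivrMr ?exprn_gt0//.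
rewrite [N g ^+ n.+1]exprS mulrCA divfK ?expf_neq0 ?gt_eqF//.
by rewrite exprS -mulrA (usnM uN).
Qed.

Let a_cvg h : cvgn (a h).
Proof.
by apply: nonincreasing_is_cvgn; [exact: a_dec|exists 0 => _ [n _ <-]; exact: a_ge0].
Qed.

Lemma localized_cvg h :
  (fun n => N (g ^+ n * h) / N g ^+ n) @ \oo --> localized N g h.
Proof. exact: a_cvg. Qed.

Let loc_le h n : localized N g h <= a h n.
Proof. exact: (nonincreasing_cvgn_ge (@a_dec h) (@a_cvg h) n). Qed.

Let loc_ge h c : (forall n, c <= a h n) -> c <= localized N g h.
Proof. by move=> H; apply: limr_ge; [exact: a_cvg|apply: nearW]. Qed.

Lemma localized_le h : localized N g h <= N h.
Proof. by have := loc_le h 0; rewrite /a !expr0 mul1r divr1. Qed.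

Lemma localizedM h : localized N g (g * h) = N g * localized N g h.
Proof.
apply: cvg_lim => //.
have -> : (fun n => N (g ^+ n * (g * h)) / N g ^+ n) = (fun n => N g * a h n.+1).
  apply/funext => n; rewrite /a mulrA -exprSr (exprS (N g)) invfM.
  by rewrite mulrCA (mulrA (N g)) divff ?gt_eqF// mul1r.
apply: cvgMl_tmp => //.
by rewrite (cvg_shiftS (a h)); exact: a_cvg.
Qed.

(** The sequences defining the localization decrease, and the term of index [2n]
for [h * k] is at most the product of the terms of index [n] for [h] and [k],
with equality for squares; so both multiplicative properties pass to the limit. *)
Lemma localized_uniform : uniform_seminorm (localized N g).
Proof.
have ge0 h : 0 <= localized N g h by apply: loc_ge => n; exact: a_ge0.
have a2 h k n : a (h * k) (n + n)%N <= a h n * a k n.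
  rewrite /a !exprD mulrACA mulf_div ler_pM2r ?invr_gt0 ?mulr_gt0 ?exprn_gt0//.
  exact: usnM.
have sub h k : localized N g (h * k) <= localized N g h * localized N g k.
  rewrite -limM; try exact: a_cvg.
  apply: limr_ge; first by apply: is_cvgM; exact: a_cvg.
  by apply: nearW => n; apply: le_trans (loc_le _ (n + n)) (a2 _ _ _).
split => //.
- apply/eqP; rewrite eq_le ge0 andbT.
  by rewrite (le_trans (localized_le _))// (usn0 uN).
- apply/eqP; rewrite eq_le -{1}(usn1 uN) localized_le/=.
  apply: loc_ge => n.
  by rewrite /a mulr1 (usnX uN) divff// expf_neq0// gt_eqF.
- move=> h k; rewrite -limD; try exact: a_cvg.
  apply: limr_ge; first by apply: is_cvgD; exact: a_cvg.
  apply: nearW => n; apply: le_trans (loc_le _ n) _.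
  rewrite /a -mulrDl ler_pM2r ?invr_gt0 ?exprn_gt0// mulrBr.
  exact: usnB.
- move=> h; apply/eqP; rewrite eq_le expr2 sub/=.
  apply: loc_ge => n.
  apply: (@le_trans _ _ (a h n * a h n)); first by rewrite ler_pM.
  have -> : a h n * a h n = a (h * h) (n + n)%N.
    by rewrite /a !exprD [in RHS]mulrACA (usn_sqr uN) mulf_div expr2.
  by apply: a_dec; rewrite leq_addr.
Qed.

End Localized.

Section ChainInf.
Variable C : set (A -> R).
Hypotheses (C0 : C !=set0) (uC : forall N, C N -> uniform_seminorm N).
Hypothesis Ctot : forall N M, C N -> C M -> (forall x, N x <= M x) \/ (forall x, M x <= N x).

Definition chain_inf x : R := inf [set N x | N in C].

Let vals_inf x : has_inf [set N x | N in C].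
Proof.
split; first by have [N CN] := C0; exists (N x); exists N.
by exists 0 => _ [N CN <-]; exact: usn_ge0 (uC CN) _.
Qed.

Lemma chain_inf_le N x : C N -> chain_inf x <= N x.
Proof. by move=> CN; apply: ge_inf; [case: (vals_inf x)|exists N]. Qed.

Lemma chain_inf_ge x c : (forall N, C N -> c <= N x) -> c <= chain_inf x.
Proof.
by move=> H; apply: lb_le_inf; [case: (vals_inf x)|move=> _ [N CN <-]; exact: H].
Qed.

Lemma chain_inf_uniform : uniform_seminorm chain_inf.
Proof.
have ge0 x : 0 <= chain_inf x.
  by apply: chain_inf_ge => N CN; exact: usn_ge0 (uC CN) _.
have common N M : C N -> C M ->
    exists2 Q, C Q & forall x, Q x <= N x /\ Q x <= M x.
  by move=> CN CM; case: (Ctot CN CM) => H; [exists N|exists M] => // x; split.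
have sub x y : chain_inf (x * y) <= chain_inf x * chain_inf y.
  have mulinf z u c : 0 <= c -> (forall N, C N -> z <= N u * c) -> z <= chain_inf u * c.
    rewrite le_eqVlt => /orP[/eqP<- H|c0 H].
      by have [N CN] := C0; have := H N CN; rewrite !mulr0.
    by rewrite -ler_pdivrMr//; apply: chain_inf_ge => N CN; rewrite ler_pdivrMr// H.
  apply: (@mulinf) => // N CN; rewrite [N x * _]mulrC; apply: (@mulinf).
    exact: usn_ge0 (uC CN) _.
  move=> M CM; have [Q CQ leQ] := common _ _ CN CM.
  apply: (le_trans (chain_inf_le _ CQ)); apply: (le_trans (usnM (uC CQ) _ _)).
  by rewrite mulrC; apply: ler_pM; rewrite ?(usn_ge0 (uC CQ))//; case: (leQ x); case: (leQ y).
split => //.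
- apply/eqP; rewrite eq_le ge0 andbT; have [N CN] := C0.
  by rewrite (le_trans (chain_inf_le _ CN))// (usn0 (uC CN)).
- apply/eqP; rewrite eq_le; apply/andP; split.
    by have [N CN] := C0; rewrite -(usn1 (uC CN)) chain_inf_le.
  by apply: chain_inf_ge => N CN; rewrite (usn1 (uC CN)).
- move=> x y; rewrite -lerBlDr; apply: chain_inf_ge => N CN.
  rewrite lerBlDr [N x + _]addrC -lerBlDr; apply: chain_inf_ge => M CM; rewrite lerBlDr.
  have [Q CQ leQ] := common _ _ CN CM.
  apply: (le_trans (chain_inf_le _ CQ)); apply: (le_trans (usnB (uC CQ) _ _)).
  by rewrite addrC; apply: lerD; [case: (leQ y)|case: (leQ x)].
- move=> x; apply/eqP; rewrite eq_le {1}expr2 sub/=.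
  apply: chain_inf_ge => N CN; rewrite (usn_sqr (uC CN)).
  by rewrite lerXn2r ?nnegrE ?ge0 ?(usn_ge0 (uC CN)) ?chain_inf_le.
Qed.

End ChainInf.

(** A minimal element, among the uniform seminorms below [N] for which [f]
scales by [N f], is multiplicative: localizing it at any [g] gives another such
seminorm, hence the same one, and [g] scales its own localization.  Such
seminorms exist because [localized N f] is one; Zorn's lemma applies as an
infimum of a chain stays in the family. *)
Theorem uniform_norm_attained N f : uniform_seminorm N -> 0 < N f ->
  exists M, [/\ uniform_seminorm M, forall x y, M (x * y) = M x * M y,
                forall x, M x <= N x & M f = N f].
Proof.
move=> uN f0.
(* The third condition, stable under localization, forces [M f = N f]. *)
pose P (M : A -> R) := [/\ uniform_seminorm M, forall x, M x <= N x
                         & forall x, M (f * x) = N f * M x].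
have P0 : P (localized N f).
  by split; [exact: localized_uniform|exact: localized_le|exact: localizedM].
pose below (M Q : {M | P M}) := `[< forall x, sval Q x <= sval M x >].
have [||C totC|[M PM] Mmin] := @ZL_preorder _ (exist _ _ P0) below.
- by move=> t; apply/asboolP => x.
- move=> r s t /asboolP rs /asboolP st; apply/asboolP => x.
  exact: le_trans (st x) (rs x).
- have [C0|/set0P C0] := eqVneq C set0.
    by exists (exist _ _ P0) => s; rewrite C0.
  pose D := [set sval M | M in C].
  have D0 : D !=set0 by case: C0 => M CM; exists (sval M); exists M.
  have uD M : D M -> uniform_seminorm M by case=> [[Q [uQ ? ?]] _ <-].
  have Dtot M Q : D M -> D Q -> (forall x, M x <= Q x) \/ (forall x, Q x <= M x).
    move=> [m Cm <-] [q Cq <-]; case: (totC _ _ Cm Cq) => /asboolP H; by [right|left].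
  have PD : P (chain_inf D).
    split; first exact: chain_inf_uniform.
      move=> x; have [Q DQ] := D0; apply: (le_trans (chain_inf_le D0 uD _ DQ)).
      by case: DQ => [[M [? leM ?]] _ <-]; exact: leM.
    move=> x; apply/eqP; rewrite eq_le; apply/andP; split.
      rewrite -ler_pdivrMl//; apply: (chain_inf_ge D0 uD) => Q DQ.
      rewrite ler_pdivrMl//; apply: (le_trans (chain_inf_le D0 uD _ DQ)).
      by case: DQ => [[M [? ? scM]] _ <-]; rewrite /= scM.
    apply: (chain_inf_ge D0 uD) => Q DQ.
    have -> : Q (f * x) = N f * Q x by case: DQ => [[M [? ? scM]] _ <-]; rewrite /= scM.
    by rewrite ler_pM2l//; exact: (chain_inf_le D0 uD).
  exists (exist _ _ PD) => s Cs; apply/asboolP => x /=.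
  by apply: (chain_inf_le D0 uD); exists s.
case: (PM) => uM leM scM.
exists M; split=> //; last by have := scM 1; rewrite mulr1 (usn1 uM) mulr1.
move=> x y; have [Mx0|Mx0] := eqVneq (M x) 0.
  apply/eqP; rewrite eq_le (usnM uM)/= Mx0 mul0r.
  exact: usn_ge0 uM _.
have Mxp : 0 < M x by rewrite lt_def Mx0 (usn_ge0 uM).
have PL : P (localized M x).
  split; first exact: localized_uniform.
    by move=> z; apply: le_trans (leM z); exact: localized_le.
  move=> z; rewrite /localized.
  under eq_fun do rewrite mulrCA scM -mulrA.
  apply: cvg_lim => //; apply: cvgMl_tmp.
  exact: localized_cvg.
have /Mmin/asboolP/= LM : below (exist _ _ PM) (exist _ _ PL).
  by apply/asboolP => z; exact: localized_le.
have E z : localized M x z = M z.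
  by apply/eqP; rewrite eq_le localized_le//=; exact: LM.
by rewrite -{1}E localizedM// E.
Qed.

End UniformSeminorm.

(** * Complete ultrametric algebras *)

Section Vabs.
Variables (R : realType) (K : nonArchFieldType R).
Implicit Types x : K.

Lemma vabs0 : vabs (0 : K) = 0.
Proof. by apply/eqP; rewrite vabs_eq0. Qed.

Lemma vabsV x : x != 0 -> vabs x^-1 = (vabs x)^-1.
Proof.
move=> x0; apply: (@mulfI _ (vabs x)); first by rewrite vabs_eq0.
by rewrite -vabsM !divff ?vabs1 ?vabs_eq0.
Qed.

Lemma vabsX x n : vabs (x ^+ n) = vabs x ^+ n.
Proof. by elim: n => [|n IH]; rewrite ?expr0 ?vabs1// !exprS vabsM IH. Qed.

End Vabs.

Definition norm_cvg (R : realType) (V : zmodType) (N : V -> R) (u : nat -> V) (l : V) :=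
  forall e : R, 0 < e -> exists n0, forall n, (n0 <= n)%N -> N (u n - l) < e.

Definition norm_closed (R : realType) (V : zmodType) (N : V -> R) (S : set V) :=
  forall u l, (forall n, S (u n)) -> norm_cvg N u l -> S l.

Record ultrametric_algebra (R : realType) (K : nonArchFieldType R) (A : comAlgType K)
    (N : A -> R) : Prop := UltrametricAlgebra {
  un_ge0 : forall x, 0 <= N x ;
  un_eq0 : forall x, N x = 0 -> x = 0 ;
  un1 : N 1 = 1 ;
  unD : forall x y, N (x + y) <= Num.max (N x) (N y) ;
  unM : forall x y, N (x * y) <= N x * N y ;
  unZ : forall (k : K) x, N (k *: x) = vabs k * N x ;
  un_complete : norm_complete N
}.

Lemma geometric_small (R : realType) (C t e : R) : 0 <= t < 1 -> 0 < e ->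
  exists n0, forall n, (n0 <= n)%N -> C * t ^+ n < e.
Proof.
move=> /andP[t0 t1] e0.
have /cvgrPdist_lt /(_ e e0) [n0 _ H] : (fun n => C * t ^+ n) @ \oo --> C * 0.
  by apply: cvgMl_tmp; apply: cvg_expr; rewrite ger0_norm.
exists n0 => n /H /=; rewrite mulr0 sub0r normrN; exact: le_lt_trans (ler_norm _).
Qed.

Section UltrametricAlgebra.
Variables (R : realType) (K : nonArchFieldType R) (A : comAlgType K) (N : A -> R).
Hypothesis uN : ultrametric_algebra N.
Implicit Types (x y l m : A) (u v : nat -> A).

Lemma un0 : N 0 = 0.
Proof. by rewrite -(scale0r (0 : A)) (unZ uN) vabs0 mul0r. Qed.

Lemma unN x : N (- x) = N x.
Proof. by rewrite -scaleN1r (unZ uN) vabsN vabs1 mul1r. Qed.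

Lemma un_distC x y : N (x - y) = N (y - x).
Proof. by rewrite -unN opprB. Qed.

Lemma un_scalar (k : K) : N k%:A = vabs k.
Proof. by rewrite (unZ uN) (un1 uN) mulr1. Qed.

Lemma unD_le x y C : N x <= C -> N y <= C -> N (x + y) <= C.
Proof. by move=> xC yC; rewrite (le_trans (unD uN _ _))// ge_max xC yC. Qed.

Lemma unB_le x y C : N x <= C -> N y <= C -> N (x - y) <= C.
Proof. by move=> xC yC; apply: unD_le => //; rewrite unN. Qed.

Lemma unD_lt x y C : N x < C -> N y < C -> N (x + y) < C.
Proof. by move=> xC yC; rewrite (le_lt_trans (unD uN _ _))// gt_max xC yC. Qed.

Lemma un_sum (I : Type) (r : seq I) (P : pred I) (F : I -> A) C :
  0 <= C -> (forall i, P i -> N (F i) <= C) -> N (\sum_(i <- r | P i) F i) <= C.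
Proof.
move=> C0 FC; apply: (big_ind (fun x => N x <= C)) => //.
  by rewrite un0.
by move=> x y; exact: unD_le.
Qed.

Lemma unX_le x C n : N x <= C -> N (x ^+ n) <= C ^+ n.
Proof.
move=> xC; elim: n => [|n IH]; first by rewrite !expr0 (un1 uN).
rewrite !exprS (le_trans (unM uN _ _))//.
by rewrite ler_pM ?(un_ge0 uN).
Qed.

Lemma un_cvg_bound u l y C n0 : norm_cvg N u l ->
  (forall n, (n0 <= n)%N -> N (u n - y) <= C) -> N (l - y) <= C.
Proof.
move=> ul uC; apply/ler_addgt0Pr => e e0.
have [n1 H] := ul e e0; set n := maxn n0 n1.
have -> : l - y = - (u n - l) + (u n - y) by rewrite opprB addrA subrK.
have C0 : 0 <= C by apply: le_trans (uC n0 _); rewrite ?(un_ge0 uN).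
apply: unD_le; first by rewrite unN ltW// (lt_le_trans (H n _)) ?leq_maxr ?lerDr.
by rewrite (le_trans (uC n _)) ?leq_maxl// lerDl ltW.
Qed.

Lemma un_cvg_unique u l m : norm_cvg N u l -> norm_cvg N u m -> l = m.
Proof.
move=> ul um; apply/eqP; rewrite -subr_eq0; apply/eqP/(un_eq0 uN)/eqP.
rewrite eq_le (un_ge0 uN) andbT; apply/ler_addgt0Pr => e e0; rewrite add0r.
have [n0 H] := um e e0; apply: (un_cvg_bound (n0 := n0) ul) => n /H; exact: ltW.
Qed.

Lemma un_cvgB u v l m : norm_cvg N u l -> norm_cvg N v m ->
  norm_cvg N (fun n => u n - v n) (l - m).
Proof.
move=> ul vm e e0; have [n1 H1] := ul e e0; have [n2 H2] := vm e e0.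
exists (maxn n1 n2) => n; rewrite geq_max => /andP[h1 h2].
have -> : u n - v n - (l - m) = (u n - l) - (v n - m) by ring.
by apply: unD_lt; rewrite ?unN; [exact: H1|exact: H2].
Qed.

Lemma un_cvgM u v l m : norm_cvg N u l -> norm_cvg N v m ->
  norm_cvg N (fun n => u n * v n) (l * m).
Proof.
move=> ul vm e e0.
pose M := Num.max 1 (Num.max (N l) (N m)).
have M1 : 1 <= M by rewrite le_max lexx.
have Ml : N l <= M by rewrite !le_max lexx orbT.
have Mm : N m <= M by rewrite !le_max lexx !orbT.
have M0 : 0 < M by apply: lt_le_trans M1.
(* [d * M <= e] bounds the linear terms, and [d <= M] then bounds the product of
the two errors. *)
pose d := Num.min M (e / M).
have d0 : 0 < d by rewrite lt_min M0 divr_gt0.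
have [n1 H1] := ul d d0; have [n2 H2] := vm d d0.
exists (maxn n1 n2) => n; rewrite geq_max => /andP[/H1 h1 /H2 h2].
have -> : u n * v n - l * m = (u n - l) * (v n - m) + ((u n - l) * m + l * (v n - m)).
  by ring.
have bnd x y : N x < d -> N y <= M -> N (x * y) < e.
  move=> xd yM; apply: le_lt_trans (unM uN _ _) _.
  apply: (@le_lt_trans _ _ (N x * M)); first by rewrite ler_wpM2l ?(un_ge0 uN).
  by rewrite -ltr_pdivlMr// (lt_le_trans xd)// ge_min lexx orbT.
apply: unD_lt; first by apply: bnd => //; rewrite ltW// (lt_le_trans h2)// ge_min lexx.
by apply: unD_lt; [|rewrite mulrC]; apply: bnd.
Qed.

Lemma un_cvg_cst x : norm_cvg N (fun=> x) x.
Proof. by move=> e e0; exists 0%N => n _; rewrite subrr un0. Qed.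

Lemma un_cvg_geometric u l C t : 0 <= t < 1 ->
  (forall n, N (u n - l) <= C * t ^+ n) -> norm_cvg N u l.
Proof.
move=> t01 H e e0; have [n0 Hn] := geometric_small C t01 e0.
by exists n0 => n /Hn; apply: le_lt_trans.
Qed.

Lemma un_cvg_step u C t : 0 <= t < 1 -> 0 <= C ->
  (forall n, N (u n.+1 - u n) <= C * t ^+ n) -> exists l, norm_cvg N u l.
Proof.
move=> t01 C0 H; apply: (un_complete uN) => e e0.
have [n0 Hn] := geometric_small C t01 e0; exists n0 => m n.
have /andP[t0 /ltW t1] := t01.
have tail k : N (u (n0 + k)%N - u n0) <= C * t ^+ n0.
  elim: k => [|k IH]; first by rewrite addn0 subrr un0 mulr_ge0 ?exprn_ge0.
  have -> : u (n0 + k.+1)%N - u n0 = (u (n0 + k).+1 - u (n0 + k)%N) + (u (n0 + k)%N - u n0).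
    by rewrite addnS addrA subrK.
  apply: unD_le => //; apply: (le_trans (H _)).
  by rewrite ler_wpM2l// exprD ler_piMr ?exprn_ge0 ?exprn_ile1.
move=> /subnKC <- /subnKC <-; apply: le_lt_trans (Hn n0 (leqnn _)).
set a := u _; set b := u _; have -> : a - b = (a - u n0) - (b - u n0) by ring.
by apply: unB_le; exact: tail.
Qed.

(** Banach's fixed point theorem, on a closed subset. *)
Lemma un_contraction (S : set A) (F : A -> A) t x0 : norm_closed N S ->
  (forall x, S x -> S (F x)) -> 0 <= t < 1 ->
  (forall x y, S x -> S y -> N (F x - F y) <= t * N (x - y)) -> S x0 ->
  exists2 x, S x & F x = x.
Proof.
move=> Scl SF t01 FC Sx0; have /andP[t0 t1] := t01.
pose u n := iter n F x0.
have Su n : S (u n) by elim: n => //= n; exact: SF.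
have [l ul] : exists l, norm_cvg N u l.
  apply: (un_cvg_step (C := N (u 1%N - u 0%N)) t01); first exact: un_ge0.
  elim=> [|n IH]; first by rewrite expr0 mulr1.
  apply: (le_trans (FC (u n.+1) (u n) (Su _) (Su _))).
  by rewrite exprS mulrCA ler_wpM2l.
have Sl := Scl u l Su ul.
exists l => //; apply: (@un_cvg_unique (fun n => u n.+1)); last first.
  by move=> e /ul[n0 H]; exists n0 => n n0n; rewrite H// leqW.
move=> e /ul[n0 H]; exists n0 => n /H; apply: le_lt_trans.
apply: (le_trans (FC _ _ (Su _) Sl)).
by rewrite ler_piMl ?(un_ge0 uN)// ltW.
Qed.

(** The inverse is the fixed point of [1 - x * y]. *)
Lemma add1_invertible x : N x < 1 -> exists y, (1 + x) * y = 1.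
Proof.
move=> x1; have x01 : 0 <= N x < 1 by rewrite (un_ge0 uN).
have [//|//|y z _ _|//|y _ E] := @un_contraction setT (fun y => 1 - x * y) (N x) 0 _ _ x01.
  have -> : 1 - x * y - (1 - x * z) = - (x * (y - z)) by ring.
  by rewrite unN (unM uN).
by exists y; rewrite mulrDl mul1r -{1}E subrK.
Qed.

End UltrametricAlgebra.

(** * The exponential on a small ball *)

Lemma triangular_sum (V : nmodType) (F : nat -> nat -> V) n :
  \sum_(k < n) \sum_(i < k.+1) F i (k - i)%N = \sum_(i < n) \sum_(j < n - i) F i j.
Proof.
elim: n => [|n IH]; first by rewrite !big_ord0.
rewrite big_ord_recr /= IH [RHS](eq_bigr (fun i : 'I_n.+1 =>
  \sum_(j < n - i) F i j + F i (n - i)%N)); last first.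
  by move=> i _; rewrite subSn ?big_ord_recr// -ltnS.
rewrite big_split /=; congr (_ + _).
by rewrite big_ord_recr /= subnn big_ord0 addr0.
Qed.

Section Exponential.
Variables (R : realType) (K : nonArchFieldType R) (A : comAlgType K) (N : A -> R).
Hypothesis uN : ultrametric_algebra N.
Variable t : R.
Hypotheses (t_gt0 : 0 < t) (t_lt1 : t < 1).
(* For the p-adic absolute value, [t] is the square root of the absolute value of
[p], so that the ball of radius [t ^+ 2] below is [p] times the unit ball. *)
Hypothesis fact_ge : forall k, t ^+ k <= vabs (k.+1`!%:R : K).
Implicit Types (x y : A).

Let t_le1 : t <= 1. Proof. exact: ltW. Qed.
Let t_ge0 : 0 <= t. Proof. exact: ltW. Qed.

Definition exp_term x k : A := (k`!%:R : K)^-1 *: x ^+ k.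
Definition exp_sum n x : A := \sum_(k < n) exp_term x k.
(** The value is [0] where the series diverges. *)
Definition alg_exp x : A := xget 0 [set l | norm_cvg N (exp_sum ^~ x) l].

Lemma fact_neq0 k : (k`!%:R : K) != 0.
Proof.
rewrite -(@vabs_eq0 R); case: k => [|k]; first by rewrite vabs1 oner_eq0.
by rewrite gt_eqF// (lt_le_trans _ (fact_ge k)) ?exprn_gt0.
Qed.

Lemma fact_inv_le k : t ^+ k * vabs (k.+1`!%:R^-1 : K) <= 1.
Proof.
rewrite vabsV ?fact_neq0// ler_pdivrMr ?mul1r//.
by rewrite (lt_le_trans _ (fact_ge k)) ?exprn_gt0.
Qed.

Lemma exp_term_le x k : N x <= t ^+ 2 -> N (exp_term x k) <= t ^+ k.
Proof.
move=> xt; rewrite /exp_term (unZ uN); case: k => [|k].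
  by rewrite fact0 invr1 vabs1 mul1r !expr0 (un1 uN).
apply: (@le_trans _ _ (vabs (k.+1`!%:R^-1 : K) * (t ^+ 2) ^+ k.+1)).
  by rewrite ler_wpM2l ?vabs_ge0// unX_le.
have -> : (t ^+ 2) ^+ k.+1 = t ^+ k * t ^+ k.+2.
  by rewrite -exprM -exprD; congr (t ^+ _); rewrite mul2n -addnn addSnnS.
rewrite mulrA [_ * t ^+ k]mulrC -[leRHS]mul1r.
apply: ler_pM; [by rewrite mulr_ge0 ?exprn_ge0 ?vabs_ge0|exact: exprn_ge0|exact: fact_inv_le|].
by rewrite (exprS t k.+1) ler_piMl ?exprn_ge0.
Qed.

Lemma alg_expE x l : norm_cvg N (exp_sum ^~ x) l -> alg_exp x = l.
Proof.
by move=> xl; apply: xget_unique => [|m /= ml]; [exact: xl|exact: (un_cvg_unique uN ml xl)].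
Qed.

Lemma alg_expP x : N x <= t ^+ 2 -> norm_cvg N (exp_sum ^~ x) (alg_exp x).
Proof.
move=> xt; apply: (@xgetPex _ 0 [set l | norm_cvg N (exp_sum ^~ x) l]).
apply: (un_cvg_step uN (t := t) (C := 1)); rewrite ?t_ge0//.
by move=> n; rewrite /exp_sum big_ord_recr /= addrC addrK mul1r exp_term_le.
Qed.

Lemma alg_exp0 : alg_exp 0 = 1.
Proof.
apply: alg_expE => e e0; exists 1%N => -[//|n] _.
rewrite /exp_sum big_ord_recl big1 ?addr0 => [|i _].
  by rewrite /exp_term fact0 invr1 scale1r expr0 subrr un0.
by rewrite /exp_term exprS mul0r scaler0.
Qed.

(** The difference quotient of the exponential is the sum of the terms below,
in which everything after the leading [1] is small; so the exponential is an
isometry on the ball, and it changes the differences by invertible factors. *)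
Lemma alg_exp_factor x y : N x <= t ^+ 2 -> N y <= t ^+ 2 ->
  exists2 g, alg_exp x - alg_exp y = (x - y) * g & N (g - 1) <= t.
Proof.
move=> xt yt.
pose G k := (k`!%:R : K)^-1 *: (\sum_(i < k) x ^+ (k.-1 - i) * y ^+ i).
have Gle k : N (G k.+1) <= t ^+ k.
  rewrite /G (unZ uN); apply: (@le_trans _ _ (vabs (k.+1`!%:R^-1 : K) * (t ^+ 2) ^+ k)).
    rewrite ler_wpM2l ?vabs_ge0//; apply: (un_sum uN); first by rewrite !exprn_ge0.
    move=> i _ /=; rewrite (le_trans (unM uN _ _))//.
    have ik : (i <= k)%N by rewrite -ltnS.
    by rewrite -[X in _ <= _ ^+ X](subnK ik) exprD ler_pM ?(un_ge0 uN)// unX_le.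
  rewrite -exprM mul2n -addnn exprD mulrA [_ * t ^+ k]mulrC.
  by rewrite ler_piMr ?exprn_ge0// mulrC fact_inv_le.
pose g n := \sum_(k < n) G k.
have sumE n : exp_sum n x - exp_sum n y = (x - y) * g n.
  rewrite /exp_sum /g -sumrB mulr_sumr; apply: eq_bigr => k _.
  by rewrite /exp_term -scalerBr subrXX scalerAr.
have [l gl] : exists l, norm_cvg N (fun n => g n.+1) l.
  apply: (un_cvg_step uN (t := t) (C := 1)); rewrite ?t_ge0//.
  by move=> n; rewrite /g big_ord_recr /= addrC addrK mul1r Gle.
exists l; last first.
  apply: (un_cvg_bound (n0 := 1) uN gl) => -[//|n] _.
  have -> : g n.+2 - 1 = \sum_(k < n) G k.+2.
    rewrite /g 2!big_ord_recl /= {1}/G big_ord0 scaler0 add0r.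
    rewrite {1}/G big_ord_recl big_ord0 /= !expr0 mulr1 addr0 invr1 scale1r addrC addKr.
    by apply: eq_bigr.
  apply: (un_sum uN) => // k _; rewrite (le_trans (Gle _))//.
  by rewrite exprS ler_piMr// exprn_ile1.
have shift (u : nat -> A) m : norm_cvg N u m -> norm_cvg N (fun n => u n.+1) m.
  by move=> um e /um[n0 H]; exists n0 => n n0n; rewrite H// leqW.
apply: (un_cvg_unique uN (u := fun n => exp_sum n.+1 x - exp_sum n.+1 y)).
  apply: (un_cvgB uN); first exact: (shift (exp_sum ^~ x) _ (alg_expP xt)).
  exact: (shift (exp_sum ^~ y) _ (alg_expP yt)).
have -> : (fun n => exp_sum n.+1 x - exp_sum n.+1 y) = (fun n => (x - y) * g n.+1).
  by apply/funext => n; rewrite sumE.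
by apply: (un_cvgM uN) => //; exact: un_cvg_cst.
Qed.

Lemma alg_exp_approx x y : N x <= t ^+ 2 -> N y <= t ^+ 2 ->
  N ((alg_exp x - 1 - x) - (alg_exp y - 1 - y)) <= t * N (x - y).
Proof.
move=> xt yt; have [g E g1] := alg_exp_factor xt yt.
have -> : alg_exp x - 1 - x - (alg_exp y - 1 - y) = (alg_exp x - alg_exp y) - (x - y) by ring.
have -> : alg_exp x - alg_exp y - (x - y) = (x - y) * (g - 1) by rewrite E mulrBr mulr1.
by rewrite (le_trans (unM uN _ _))// mulrC ler_wpM2r ?(un_ge0 uN).
Qed.

Lemma alg_exp_isometry x y : N x <= t ^+ 2 -> N y <= t ^+ 2 ->
  N (alg_exp x - alg_exp y) = N (x - y).
Proof.
move=> xt yt.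
have := alg_exp_approx xt yt; set d := N (x - y) => dle.
have d0 : 0 <= d by exact: un_ge0.
have E : alg_exp x - alg_exp y = (alg_exp x - 1 - x - (alg_exp y - 1 - y)) + (x - y) by ring.
apply/eqP; rewrite eq_le; apply/andP; split.
  by rewrite E unD_le// (le_trans dle)// ler_piMl.
rewrite leNgt; apply/negP => lt.
have : d < d.
  rewrite {1}/d.
  have -> : x - y = (alg_exp x - alg_exp y) - (alg_exp x - 1 - x - (alg_exp y - 1 - y)).
    by ring.
  apply: (unD_lt uN) => //; rewrite (unN uN) (le_lt_trans dle)// gtr_pMl//.
  by rewrite (le_lt_trans _ lt) ?(un_ge0 uN).
by rewrite ltxx.
Qed.

(** The solution [x] of [alg_exp x = 1 + v] is the fixed point of the map
[v - (alg_exp x - 1 - x)], so no logarithm is needed. *)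
Lemma alg_exp_onto (S : set A) v : norm_closed N S -> (forall x, S x -> N x <= t ^+ 2) ->
  S 0 -> (forall x, S x -> S (v - (alg_exp x - 1 - x))) ->
  exists2 x, S x & alg_exp x = 1 + v.
Proof.
move=> Scl Sball S0 Sv.
have t01 : 0 <= t < 1 by rewrite t_ge0.
have [|x Sx E] := un_contraction uN Scl Sv t01 _ S0.
- move=> x y Sx Sy; rewrite (un_distC uN).
  have -> : v - (alg_exp y - 1 - y) - (v - (alg_exp x - 1 - x)) =
            (alg_exp x - 1 - x) - (alg_exp y - 1 - y) by ring.
  by apply: alg_exp_approx; exact: Sball.
by exists x => //; rewrite -[in RHS](subrK x v) -{2}E; ring.
Qed.

Lemma exp_ball_closed : norm_closed N [set x | N x <= t ^+ 2].
Proof.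
move=> u l ut ul /=; rewrite -(subr0 l); apply: (un_cvg_bound (n0 := 0) uN ul) => n _.
by rewrite subr0; exact: ut.
Qed.

Lemma alg_exp_ball_onto v : N v <= t ^+ 2 -> exists2 x, N x <= t ^+ 2 & alg_exp x = 1 + v.
Proof.
move=> vt; apply: (alg_exp_onto exp_ball_closed) => //=.
  by rewrite un0// exprn_ge0.
move=> x xt; apply: (unB_le uN) => //.
have := alg_exp_approx xt (y := 0); rewrite (un0 uN) alg_exp0 !subrr !subr0 => H.
by rewrite (le_trans (H _)) ?exprn_ge0// (le_trans _ xt)// ler_piMl ?(un_ge0 uN).
Qed.

(** The product of two partial sums of length [n] and the partial sum of
[x + y] differ by the terms with [i + j >= n], whose norm is at most
[t ^+ n]. *)
Lemma alg_expD x y : N x <= t ^+ 2 -> N y <= t ^+ 2 ->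
  alg_exp (x + y) = alg_exp x * alg_exp y.
Proof.
move=> xt yt; have xyt : N (x + y) <= t ^+ 2 by apply: unD_le.
apply/eqP; rewrite eq_sym -subr_eq0; apply/eqP; apply: (un_cvg_unique uN).
  by apply: (un_cvgB uN); [apply: (un_cvgM uN)|]; apply: alg_expP.
apply: (un_cvg_geometric (C := 1) (t := t)) => [|n]; first by rewrite t_ge0.
rewrite subr0 mul1r.
pose F i j := exp_term x i * exp_term y j.
have Dterm k : exp_term (x + y) k = \sum_(i < k.+1) F i (k - i)%N.
  rewrite {1}/exp_term addrC exprDn scaler_sumr; apply: eq_bigr => i _.
  have ik : (i <= k)%N by rewrite -ltnS.
  rewrite /F /exp_term -scalerAl -scalerAr scalerA -scaler_nat scalerA mulrC [y ^+ _ * _]mulrC.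
  congr (_ *: _); apply: (canLR (mulfK (fact_neq0 k))).
  by rewrite -(bin_fact ik) !natrM -invfM mulrC mulfK ?mulf_neq0 ?fact_neq0.
rewrite /exp_sum; under [X in _ - X]eq_bigr do rewrite Dterm.
rewrite (triangular_sum F).
rewrite mulr_suml -sumrB; apply: (un_sum uN) => [|i _]; first exact: exprn_ge0.
rewrite mulr_sumr.
have -> : \sum_(j < n) exp_term x i * exp_term y j - \sum_(j < n - i) F i j =
          \sum_(n - i <= j < n) F i j.
  rewrite -(big_mkord xpredT (F i)) -(big_mkord xpredT (F i)).
  by rewrite (@big_cat_nat _ _ _ (n - i))//= ?leq_subr// addrAC subrr add0r.
rewrite big_seq_cond; apply: (un_sum uN) => [|j]; first exact: exprn_ge0.
rewrite andbT mem_index_iota => /andP[jn _].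
apply: le_trans (unM uN _ _) _.
apply: (@le_trans _ _ (t ^+ i * t ^+ j)); first by rewrite ler_pM ?(un_ge0 uN)// exp_term_le.
rewrite -exprD; have ij : (n <= i + j)%N by rewrite -leq_subLR.
by rewrite -(subnKC ij) exprD ler_piMr ?exprn_ge0 ?exprn_ile1.
Qed.

Lemma alg_expMn x n : N x <= t ^+ 2 -> alg_exp (x *+ n) = alg_exp x ^+ n.
Proof.
move=> xt; have xnt k : N (x *+ k) <= t ^+ 2.
  elim: k => [|k IH]; first by rewrite mulr0n un0// exprn_ge0.
  by rewrite mulrS unD_le.
elim: n => [|n IH]; first by rewrite mulr0n alg_exp0 expr0.
by rewrite mulrS alg_expD// IH exprS.
Qed.

End Exponential.

(** * Bounded operators *)

Lemma le0_eps (R : realType) (x C : R) : (forall e, 0 < e -> x <= e * C) -> x <= 0.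
Proof.
move=> H; have [C0|C0] := leP C 0.
  by apply: (le_trans (H 1 ltr01)); rewrite mul1r.
by apply/ler_addgt0Pr => e e0; rewrite add0r -[e](divfK (lt0r_neq0 C0)) H// divr_gt0.
Qed.

Lemma small_factor (R : realType) (c e : R) : 0 <= c -> 0 < e -> exists2 d, 0 < d &
  forall a, 0 <= a < d -> c * a < e.
Proof.
move=> c0 e0; have c1 : 0 < c + 1 by rewrite ltr_wpDl.
exists (e / (c + 1)); first by rewrite divr_gt0.
move=> a /andP[a0 ad]; apply: (@le_lt_trans _ _ ((c + 1) * a)).
  by rewrite ler_wpM2r// lerDl.
by rewrite mulrC -ltr_pdivlMr.
Qed.

Section Operators.
Variables (R : realType) (K : nonArchFieldType R) (B : nonArchBanachType K).
Implicit Types (x y : B) (S T U V : B -> B).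

Lemma vnorm0 : vnorm (0 : B) = 0.
Proof. by apply/eqP; rewrite vnorm_eq0. Qed.

Lemma vnormN x : vnorm (- x) = vnorm x.
Proof. by rewrite -scaleN1r vnormZ vabsN vabs1 mul1r. Qed.

Lemma vnormD_le x y C : vnorm x <= C -> vnorm y <= C -> vnorm (x + y) <= C.
Proof. by move=> xC yC; rewrite (le_trans (vnorm_ultra _ _))// ge_max xC yC. Qed.

Lemma vnormB_le x y C : vnorm x <= C -> vnorm y <= C -> vnorm (x - y) <= C.
Proof. by move=> xC yC; rewrite vnormD_le// vnormN. Qed.

Lemma bounded0 T : bounded_op T -> T 0 = 0.
Proof. by case=> lT _; have := lT (-1) 0 0; rewrite !scaleN1r !addNr. Qed.

Lemma boundedD T x y : bounded_op T -> T (x + y) = T x + T y.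
Proof. by case=> lT _; have := lT 1 x y; rewrite !scale1r. Qed.

Lemma boundedZ T k x : bounded_op T -> T (k *: x) = k *: T x.
Proof. by move=> bT; have := bT.1 k x 0; rewrite !addr0 bounded0// addr0. Qed.

Lemma boundedB T x y : bounded_op T -> T (x - y) = T x - T y.
Proof. by move=> bT; rewrite boundedD// -scaleN1r boundedZ// scaleN1r. Qed.

Lemma opnorm_le_bound T C : 0 <= C -> (forall x, vnorm (T x) <= C * vnorm x) -> opnorm T <= C.
Proof.
move=> C0 H; apply: ge_sup; first by exists (vnorm (T 0) / vnorm (0 : B)); exists 0.
move=> _ [x _ <-]; have [->|x0] := eqVneq x 0; first by rewrite vnorm0 invr0 mulr0.
by rewrite ler_pdivrMr// lt_def vnorm_eq0 x0 vnorm_ge0.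
Qed.

Let opnorm_ub T : bounded_op T -> has_ubound (range (fun x => vnorm (T x) / vnorm x)).
Proof.
move=> [_ [C HC]]; exists (Num.max 0 C) => _ [y _ <-].
have [->|y0] := eqVneq y 0; first by rewrite vnorm0 invr0 mulr0 le_max lexx.
rewrite ler_pdivrMr ?lt_def ?vnorm_eq0 ?y0 ?vnorm_ge0// (le_trans (HC _))//.
by rewrite ler_wpM2r ?vnorm_ge0// le_max lexx orbT.
Qed.

Lemma opnorm_apply T x : bounded_op T -> vnorm (T x) <= opnorm T * vnorm x.
Proof.
move=> bT; have [->|x0] := eqVneq x 0; first by rewrite bounded0// vnorm0 mulr0.
rewrite -ler_pdivrMr ?lt_def ?vnorm_eq0 ?x0 ?vnorm_ge0//.
by apply: ub_le_sup; [exact: opnorm_ub|exists x].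
Qed.

Lemma opnorm_ge0 T : bounded_op T -> 0 <= opnorm T.
Proof.
move=> bT; apply: ub_le_sup; first exact: opnorm_ub.
by exists 0 => //; rewrite vnorm0 invr0 mulr0.
Qed.

Lemma boundedP T C : linear T -> (forall x, vnorm (T x) <= C * vnorm x) -> bounded_op T.
Proof. by move=> lT H; split=> //; exists C. Qed.

Lemma opnorm_eq0 T : bounded_op T -> opnorm T = 0 -> T = 0.
Proof.
move=> bT T0; apply/funext => x; apply/eqP; rewrite -[_ == _](vnorm_eq0 (T x)).
by rewrite eq_le vnorm_ge0 andbT (le_trans (opnorm_apply x bT))// T0 mul0r.
Qed.

Let bounded_addr S T : bounded_op S -> bounded_op T -> linear (S + T).
Proof.
move=> [lS _] [lT _] a x y; rewrite /= /GRing.add /= lS lT scalerDr.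
by rewrite addrACA.
Qed.

Let opnormD_apply S T x : bounded_op S -> bounded_op T ->
  vnorm ((S + T) x) <= Num.max (opnorm S) (opnorm T) * vnorm x.
Proof.
move=> bS bT; apply: vnormD_le.
  by apply: (le_trans (opnorm_apply x bS)); rewrite ler_wpM2r ?vnorm_ge0// le_max lexx.
by apply: (le_trans (opnorm_apply x bT)); rewrite ler_wpM2r ?vnorm_ge0// le_max lexx orbT.
Qed.

Lemma bounded_add S T : bounded_op S -> bounded_op T -> bounded_op (S + T).
Proof.
by move=> bS bT; apply: boundedP (bounded_addr bS bT) _ => x; exact: opnormD_apply.
Qed.

Lemma opnormD S T : bounded_op S -> bounded_op T ->
  opnorm (S + T) <= Num.max (opnorm S) (opnorm T).
Proof.
move=> bS bT; apply: opnorm_le_bound => [|x]; last exact: opnormD_apply.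
by rewrite le_max opnorm_ge0.
Qed.

Let opnormZ_apply k T x : bounded_op T ->
  vnorm ((k *: T) x) <= vabs k * opnorm T * vnorm x.
Proof.
by move=> bT; rewrite /= vnormZ -mulrA ler_wpM2l ?vabs_ge0// opnorm_apply.
Qed.

Lemma bounded_scale k T : bounded_op T -> bounded_op (k *: T).
Proof.
move=> bT; apply: boundedP => [a x y|x]; last exact: opnormZ_apply.
change (k *: T (a *: x + y) = a *: (k *: T x) + k *: T y).
by rewrite bT.1 scalerDr !scalerA mulrC.
Qed.

Lemma opnormZ k T : bounded_op T -> opnorm (k *: T) = vabs k * opnorm T.
Proof.
have le (a : K) S : bounded_op S -> opnorm (a *: S) <= vabs a * opnorm S.
  move=> bS; apply: opnorm_le_bound => [|x]; last exact: opnormZ_apply.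
  by rewrite mulr_ge0 ?vabs_ge0 ?opnorm_ge0.
move=> bT; apply/eqP; rewrite eq_le le//=.
have [->|k0] := eqVneq k 0.
  by rewrite vabs0 mul0r opnorm_ge0//; exact: bounded_scale.
have vk : 0 < vabs k by rewrite lt_def vabs_eq0 k0 vabs_ge0.
rewrite -ler_pdivlMl//; have := le k^-1 _ (bounded_scale k bT).
by rewrite scalerA mulVf// scale1r vabsV.
Qed.

Lemma bounded_id : bounded_op (idfun : B -> B).
Proof. by apply: (@boundedP _ 1) => [a x y|x] //; rewrite mul1r. Qed.

Lemma opnorm_id : (exists x : B, x != 0) -> opnorm (idfun : B -> B) = 1.
Proof.
move=> [x x0]; apply/eqP; rewrite eq_le; apply/andP; split.
  by apply: opnorm_le_bound => // y; rewrite mul1r.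
have vx : 0 < vnorm x by rewrite lt_def vnorm_eq0 x0 vnorm_ge0.
by rewrite -(ler_pM2r vx) mul1r (opnorm_apply x bounded_id).
Qed.

Let opnorm_comp_apply S T x : bounded_op S -> bounded_op T ->
  vnorm ((S \o T) x) <= opnorm S * opnorm T * vnorm x.
Proof.
move=> bS bT; apply: (le_trans (opnorm_apply _ bS)).
by rewrite -mulrA ler_wpM2l ?opnorm_ge0// opnorm_apply.
Qed.

Lemma bounded_comp S T : bounded_op S -> bounded_op T -> bounded_op (S \o T).
Proof.
move=> bS bT; apply: boundedP => [a x y|x]; last exact: opnorm_comp_apply.
by rewrite /= bT.1 bS.1.
Qed.

Lemma opnorm_comp S T : bounded_op S -> bounded_op T -> opnorm (S \o T) <= opnorm S * opnorm T.
Proof.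
move=> bS bT; apply: opnorm_le_bound => [|x]; last exact: opnorm_comp_apply.
by rewrite mulr_ge0 ?opnorm_ge0.
Qed.

Lemma bounded_opp T : bounded_op T -> bounded_op (- T).
Proof. by move=> bT; rewrite -scaleN1r; exact: bounded_scale. Qed.

Lemma bounded_sub S T : bounded_op S -> bounded_op T -> bounded_op (S - T).
Proof. by move=> bS bT; apply: bounded_add => //; exact: bounded_opp. Qed.

Lemma bounded_zero : bounded_op (0 : B -> B).
Proof. by rewrite -(scale0r (idfun : B -> B)); exact/bounded_scale/bounded_id. Qed.

Lemma opnormN T : bounded_op T -> opnorm (- T) = opnorm T.
Proof. by move=> bT; rewrite -scaleN1r opnormZ// vabsN vabs1 mul1r. Qed.

Lemma opnormB_lt S T C : bounded_op S -> bounded_op T ->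
  opnorm S < C -> opnorm T < C -> opnorm (S - T) < C.
Proof.
move=> bS bT SC TC; have := opnormD bS (bounded_opp bT); rewrite opnormN// => H.
by rewrite (le_lt_trans H)// gt_max SC TC.
Qed.

(** An approximation by bounded operators forces linearity. *)
Lemma bounded_approx T :
  (forall e : R, 0 < e -> exists2 S, bounded_op S & forall x, vnorm (S x - T x) <= e * vnorm x) ->
  bounded_op T.
Proof.
move=> H; have lT : linear T.
  move=> a x y; apply/eqP; rewrite -subr_eq0 -(@vnorm_eq0 R K) eq_le vnorm_ge0 andbT.
  pose C := vnorm (a *: x + y) + (vabs a * vnorm x + vnorm y).
  apply: (@le0_eps _ _ C) => e e0; have [S bS HS] := H e e0.
  have -> : T (a *: x + y) - (a *: T x + T y) =
      a *: (S x - T x) + (S y - T y) - (S (a *: x + y) - T (a *: x + y)).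
    rewrite bS.1 scalerBr addrACA -opprD opprB [RHS]addrC.
    by rewrite subrKA.
  have hC (z : B) c : vnorm z <= e * c -> c <= C -> vnorm z <= e * C.
    by move=> zc cC; rewrite (le_trans zc)// ler_wpM2l// ltW.
  have x0 := vnorm_ge0 x; have y0 := vnorm_ge0 y; have xy0 := vnorm_ge0 (a *: x + y).
  have ax0 : 0 <= vabs a * vnorm x by rewrite mulr_ge0 ?vabs_ge0.
  apply: vnormB_le; last by apply: hC (HS _) _; rewrite /C lerDl addr_ge0.
  apply: vnormD_le; last by apply: hC (HS _) _; rewrite /C addrA lerDr addr_ge0.
  apply: (@hC _ (vabs a * vnorm x)); last by rewrite /C addrCA lerDl addr_ge0.
  by rewrite vnormZ mulrCA ler_wpM2l ?vabs_ge0.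
have [Q bQ HQ] := H 1 ltr01.
apply: (@boundedP _ (Num.max 1 (opnorm Q))) => // x.
have -> : T x = Q x - (Q x - T x) by rewrite opprB addrC subrK.
apply: vnormB_le.
  by apply: (le_trans (opnorm_apply x bQ)); rewrite ler_wpM2r ?vnorm_ge0// le_max lexx orbT.
by apply: (le_trans (HQ x)); rewrite ler_wpM2r ?vnorm_ge0// le_max lexx.
Qed.

(** The limit is taken pointwise; the Cauchy condition makes it uniform on the
unit ball. *)
Lemma opnorm_complete (u : nat -> B -> B) : (forall n, bounded_op (u n)) ->
  (forall e : R, 0 < e ->
     exists n0, forall m n, (n0 <= m)%N -> (n0 <= n)%N -> opnorm (u m - u n) < e) ->
  exists T, bounded_op T /\
    forall e : R, 0 < e -> exists n0, forall n, (n0 <= n)%N -> opnorm (u n - T) < e.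
Proof.
move=> bu cu.
have bsub m n : bounded_op (u m - u n) by exact: bounded_sub.
have /choice[T HT] x : exists l, norm_cvg (@vnorm _ _ B) (fun n => u n x) l.
  apply: vnorm_complete => e e0; have v1 : 0 < vnorm x + 1 by rewrite ltr_wpDl ?vnorm_ge0.
  have [n0 H] := cu (e / (vnorm x + 1)) (divr_gt0 e0 v1).
  exists n0 => m n hm hn.
  apply: le_lt_trans (opnorm_apply x (bsub m n)) _.
  apply: (@le_lt_trans _ _ (opnorm (u m - u n) * (vnorm x + 1))).
    by rewrite ler_wpM2l ?opnorm_ge0// lerDl.
  by rewrite -ltr_pdivlMr// H.
have unif (e : R) : 0 < e -> exists n0, forall n, (n0 <= n)%N ->
    forall x, vnorm (u n x - T x) <= e * vnorm x.
  move=> e0; have [n0 H] := cu e e0; exists n0 => n hn x.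
  apply/ler_addgt0Pr => d d0; have [n1 H1] := HT x d d0.
  pose m := maxn n0 n1.
  have -> : u n x - T x = (u n x - u m x) + (u m x - T x) by rewrite addrA subrK.
  have ev0 : 0 <= e * vnorm x by rewrite mulr_ge0 ?vnorm_ge0// ltW.
  apply: vnormD_le; last by rewrite ltW// (lt_le_trans (H1 _ _)) ?leq_maxr// lerDr.
  apply: le_trans (opnorm_apply x (bsub n m)) _.
  apply: (@le_trans _ _ (e * vnorm x)); last by rewrite lerDl ltW.
  by rewrite ler_wpM2r ?vnorm_ge0// ltW// H// leq_maxl.
have bT : bounded_op T.
  by apply: bounded_approx => e /unif[n0 H]; exists (u n0) => // x; exact: H.
exists T; split => // e e0; have e20 : 0 < e / 2 by rewrite divr_gt0.
have [n0 H] := unif _ e20; exists n0 => n hn.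
apply: (@le_lt_trans _ _ (e / 2)); last by rewrite ltr_pdivrMr// ltr_pMr// ltr1n.
by apply: opnorm_le_bound => [|x]; [exact: ltW|exact: H].
Qed.

End Operators.

(** * The Banach algebra generated by an operator *)

Section GeneratedAlgebra.
Variables (R : realType) (K : nonArchFieldType R) (B : nonArchBanachType K).
Implicit Types (x y : B) (S T U V : B -> B) (q r : {poly K}).

Lemma poly_op_wide q V n x : (size q <= n)%N ->
  poly_op q V x = \sum_(i < n) q`_i *: iter i V x.
Proof.
move=> qn; rewrite /poly_op (big_ord_widen n (fun i => q`_i *: iter i V x) qn) big_mkcond /=.
apply: eq_bigr => i _; case: ltnP => // h.
by rewrite nth_default// scale0r.
Qed.

Lemma poly_opD q r V : poly_op (q + r) V = poly_op q V + poly_op r V.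
Proof.
apply/funext => x; set n := maxn (size q) (size r).
rewrite (@poly_op_wide _ _ n) ?size_polyD//.
change ((poly_op q V + poly_op r V) x) with (poly_op q V x + poly_op r V x).
rewrite !(@poly_op_wide _ _ n) ?leq_maxl ?leq_maxr// -big_split /=.
by apply: eq_bigr => i _; rewrite coefD scalerDl.
Qed.

Lemma poly_opC k V : poly_op k%:P V = k *: idfun.
Proof.
apply/funext => x; rewrite (@poly_op_wide _ _ 1) ?size_polyC ?leq_b1//.
by rewrite big_ord1 coefC.
Qed.

Lemma poly_opMX q V : poly_op (q * 'X) V = poly_op q V \o V.
Proof.
apply/funext => x; rewrite (@poly_op_wide _ _ (size q).+1); last first.
  by rewrite (leq_trans (size_polyMleq _ _))// size_polyX addn2.
rewrite big_ord_recl coefMX /= scale0r add0r; apply: eq_bigr => i _.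
by rewrite coefMX /= -iterS iterSr.
Qed.

Lemma poly_opX V : poly_op 'X V = V.
Proof. by rewrite -(mul1r 'X) poly_opMX poly_opC scale1r. Qed.

Lemma poly_opCM k q V : poly_op (k%:P * q) V = k *: poly_op q V.
Proof.
apply/funext => x; rewrite (@poly_op_wide _ _ (size q)); last first.
  rewrite (leq_trans (size_polyMleq _ _))//.
  have := size_polyC_leq1 k; case: (size k%:P) => [|[|//]] _; last by rewrite add1n.
  by rewrite add0n leq_pred.
change ((k *: poly_op q V) x) with (k *: poly_op q V x).
rewrite /poly_op scaler_sumr; apply: eq_bigr => i _.
by rewrite coefCM scalerA.
Qed.

Section Polynomials.
Variable V : B -> B.
Hypothesis bV : bounded_op V.

Lemma bounded_poly_op q : bounded_op (poly_op q V).
Proof.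
elim/poly_ind: q => [|q c IH].
  by rewrite -(polyC0 K) poly_opC scale0r; exact: bounded_zero.
rewrite poly_opD poly_opMX poly_opC; apply: bounded_add; first exact: bounded_comp.
exact/bounded_scale/bounded_id.
Qed.

Lemma comm_poly_op S q : bounded_op S -> S \o V = V \o S ->
  S \o poly_op q V = poly_op q V \o S.
Proof.
move=> bS SV; elim/poly_ind: q => [|q c IH].
  rewrite -(polyC0 K) poly_opC scale0r; apply/funext => x /=.
  exact: bounded0.
rewrite poly_opD poly_opMX poly_opC; apply/funext => x /=.
change (S (poly_op q V (V x) + c *: x) = poly_op q V (V (S x)) + c *: S x).
rewrite boundedD// boundedZ//; congr (_ + _).
have := congr1 (@^~ (V x)) IH => /= ->.
by have := congr1 (@^~ x) SV => /= ->.
Qed.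

Lemma poly_opM q r : poly_op (q * r) V = poly_op q V \o poly_op r V.
Proof.
elim/poly_ind: q => [|q c IH].
  by rewrite mul0r -(polyC0 K) poly_opC scale0r.
rewrite mulrDl mulrAC poly_opD poly_opMX poly_opCM IH poly_opD poly_opMX poly_opC.
apply/funext => x /=.
change (poly_op q V (poly_op r V (V x)) + c *: poly_op r V x =
        poly_op q V (V (poly_op r V x)) + c *: poly_op r V x).
by have := congr1 (@^~ x) (comm_poly_op r bV erefl) => /= ->.
Qed.

Lemma gen_alg_bounded T : gen_alg V T -> bounded_op T.
Proof. by case. Qed.

Lemma gen_alg_poly q : gen_alg V (poly_op q V).
Proof.
split; first exact: bounded_poly_op.
move=> e e0; exists q; rewrite subrr -(scale0r (idfun : B -> B)).
rewrite opnormZ; last exact: bounded_id.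
by rewrite vabs0 mul0r.
Qed.

(** Membership may be tested by approximation in the algebra itself. *)
Lemma gen_alg_closed T : bounded_op T ->
  (forall e : R, 0 < e -> exists2 S, gen_alg V S & opnorm (T - S) < e) -> gen_alg V T.
Proof.
move=> bT H; split => // e e0; have [S [bS LS] TS] := H e e0.
have [q Sq] := LS e e0; exists q.
have -> : T - poly_op q V = (T - S) - (poly_op q V - S) by rewrite opprB addrA subrK.
have bq := bounded_poly_op q.
apply: opnormB_lt => //; try exact: bounded_sub.
by rewrite -opnormN ?opprB//; exact: bounded_sub.
Qed.

Lemma gen_alg_self : gen_alg V V.
Proof. by have := gen_alg_poly 'X; rewrite poly_opX. Qed.

Lemma gen_alg_id : gen_alg V idfun.
Proof. by have := gen_alg_poly 1; rewrite poly_opC scale1r. Qed.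

Lemma gen_algD S T : gen_alg V S -> gen_alg V T -> gen_alg V (S + T).
Proof.
move=> [bS LS] [bT LT]; split; first exact: bounded_add.
move=> e e0; have [q Sq] := LS e e0; have [r Tr] := LT e e0.
exists (q + r); rewrite poly_opD opprD addrACA.
have bq := bounded_poly_op q; have br := bounded_poly_op r.
by rewrite (le_lt_trans (opnormD _ _)) ?gt_max ?Sq//; exact: bounded_sub.
Qed.

Lemma gen_algM S T : gen_alg V S -> gen_alg V T -> gen_alg V (S \o T).
Proof.
move=> [bS LS] [bT LT]; split; first exact: bounded_comp.
move=> e e0; have [d1 d10 H1] := small_factor (opnorm_ge0 bT) e0.
have [q Sq] := LS d1 d10; have bq := bounded_poly_op q.
have [d2 d20 H2] := small_factor (opnorm_ge0 bq) e0.
have [r Tr] := LT d2 d20; have br := bounded_poly_op r.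
exists (q * r); rewrite poly_opM.
have bSq : bounded_op (S - poly_op q V) by exact: bounded_sub.
have bTr : bounded_op (T - poly_op r V) by exact: bounded_sub.
have -> : (S \o T) - (poly_op q V \o poly_op r V) =
    ((S - poly_op q V) \o T) + (poly_op q V \o (T - poly_op r V)).
  apply/funext => x /=.
  change (S (T x) - poly_op q V (poly_op r V x) =
    S (T x) - poly_op q V (T x) + poly_op q V (T x - poly_op r V x)).
  by rewrite (boundedB _ _ bq) addrA subrK.
apply: le_lt_trans (opnormD (bounded_comp bSq bT) (bounded_comp bq bTr)) _.
rewrite gt_max; apply/andP; split.
  by apply: le_lt_trans (opnorm_comp bSq bT) _; rewrite mulrC H1// opnorm_ge0.
by apply: le_lt_trans (opnorm_comp bq bTr) _; rewrite H2// opnorm_ge0.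
Qed.

Lemma gen_algZ k T : gen_alg V T -> gen_alg V (k *: T).
Proof.
move=> LT; have -> : k *: T = poly_op k%:P V \o T by rewrite poly_opC.
by apply: gen_algM => //; exact: gen_alg_poly.
Qed.

Lemma gen_algN T : gen_alg V T -> gen_alg V (- T).
Proof. by rewrite -scaleN1r; exact: gen_algZ. Qed.

Lemma gen_alg0 : gen_alg V 0.
Proof. by rewrite -(scale0r V); apply: gen_algZ; exact: gen_alg_self. Qed.

(** An operator that commutes with [V] commutes with all limits of polynomials in
[V]; applied first to [V], then to an element of the algebra, this makes the
algebra commutative. *)
Lemma gen_alg_comm_of S T : bounded_op S -> S \o V = V \o S -> gen_alg V T -> S \o T = T \o S.
Proof.
move=> bS SV [bT LT]; apply/eqP; rewrite -subr_eq0; apply/eqP.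
have bST : bounded_op ((S \o T) - (T \o S)) by apply: bounded_sub; exact: bounded_comp.
apply: opnorm_eq0 => //; apply/eqP; rewrite eq_le opnorm_ge0// andbT.
apply/ler_addgt0Pr => e e0; rewrite add0r.
have [d d0 Hd] := small_factor (opnorm_ge0 bS) e0.
have [q Tq] := LT d d0; have bq := bounded_poly_op q.
have bD : bounded_op (T - poly_op q V) by exact: bounded_sub.
have -> : (S \o T) - (T \o S) = (S \o (T - poly_op q V)) - ((T - poly_op q V) \o S).
  apply/funext => x /=.
  change (S (T x) - T (S x) = S (T x - poly_op q V x) - (T (S x) - poly_op q V (S x))).
  have := congr1 (@^~ x) (comm_poly_op q bS SV) => /= E.
  by rewrite (boundedB _ _ bS) E opprB addrA subrK.
apply: ltW; apply: opnormB_lt; try exact: bounded_comp.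
  by apply: le_lt_trans (opnorm_comp bS bD) _; rewrite Hd// opnorm_ge0.
by apply: le_lt_trans (opnorm_comp bD bS) _; rewrite mulrC Hd// opnorm_ge0.
Qed.

Lemma gen_alg_comm S T : gen_alg V S -> gen_alg V T -> S \o T = T \o S.
Proof.
move=> LS; apply: gen_alg_comm_of; first exact: gen_alg_bounded LS.
by rewrite (gen_alg_comm_of bV erefl LS).
Qed.

Lemma gen_alg_sub T : gen_alg V T -> gen_alg T `<=` gen_alg V.
Proof.
move=> LT S [bS LS]; apply: gen_alg_closed => // e /LS[q Sq].
exists (poly_op q T) => //; elim/poly_ind: q {Sq} => [|q c IH].
  by rewrite -(polyC0 K) poly_opC scale0r; exact: gen_alg0.
rewrite poly_opD poly_opMX poly_opC; apply: gen_algD; first exact: gen_algM.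
exact/gen_algZ/gen_alg_id.
Qed.

End Polynomials.
End GeneratedAlgebra.

(** The set type [gen_alg V], indexed by the proofs that make it a nonzero
commutative algebra under composition. *)
Definition galg (R : realType) (K : nonArchFieldType R) (B : nonArchBanachType K)
  (V : B -> B) (bV : bounded_op V) (nt : exists x : B, x != 0) : Type := gen_alg V.

Section GalgInstances.
Variables (R : realType) (K : nonArchFieldType R) (B : nonArchBanachType K).
Variables (V : B -> B) (bV : bounded_op V) (nt : exists x : B, x != 0).
Local Notation L := (galg bV nt).

HB.instance Definition _ := Choice.copy L (gen_alg V : Type).

Definition galg_of (T : B -> B) (LT : gen_alg V T) : L := SigSub (mem_set LT).
Definition galg_op (T : L) : B -> B := val (T : gen_alg V).

Lemma galgP (T : L) : gen_alg V (galg_op T).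
Proof. exact: set_valP. Qed.

Lemma galg_opK (T : B -> B) (LT : gen_alg V T) : galg_op (galg_of LT) = T.
Proof. by []. Qed.

Lemma galg_op_inj : injective galg_op.
Proof. by move=> S T; exact: val_inj. Qed.

Definition galg_add (S T : L) := galg_of (gen_algD bV (galgP S) (galgP T)).
Definition galg_opp (T : L) := galg_of (gen_algN bV (galgP T)).
Definition galg_mul (S T : L) := galg_of (gen_algM bV (galgP S) (galgP T)).
Definition galg_scale (k : K) (T : L) := galg_of (gen_algZ bV k (galgP T)).
Definition galg0 : L := galg_of (gen_alg0 bV).
Definition galg1 : L := galg_of (gen_alg_id bV).

Let addA : associative galg_add.
Proof. by move=> S T U; apply: galg_op_inj; exact: addrA. Qed.
Let addC : commutative galg_add.
Proof. by move=> S T; apply: galg_op_inj; exact: addrC. Qed.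
Let add0 : left_id galg0 galg_add.
Proof. by move=> S; apply: galg_op_inj; exact: add0r. Qed.
Let addN : left_inverse galg0 galg_opp galg_add.
Proof. by move=> S; apply: galg_op_inj; exact: addNr. Qed.

HB.instance Definition _ := GRing.isZmodule.Build L addA addC add0 addN.

Let mulA : associative galg_mul.
Proof. by move=> S T U; apply: galg_op_inj. Qed.
Let mulC : commutative galg_mul.
Proof. by move=> S T; apply: galg_op_inj; exact: (gen_alg_comm bV (galgP S) (galgP T)). Qed.
Let mul1 : left_id galg1 galg_mul.
Proof. by move=> S; apply: galg_op_inj. Qed.
Let mulD : left_distributive galg_mul (@GRing.add L).
Proof. by move=> S T U; apply: galg_op_inj. Qed.
Let one_neq0 : galg1 != 0.
Proof.
apply/eqP => /(congr1 galg_op) E; have [x /eqP] := nt; apply.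
exact: (congr1 (@^~ x) E).
Qed.

HB.instance Definition _ := GRing.Zmodule_isComNzRing.Build L mulA mulC mul1 mulD one_neq0.

Let scaleA a b (T : L) : galg_scale a (galg_scale b T) = galg_scale (a * b) T.
Proof. by apply: galg_op_inj; exact: scalerA. Qed.
Let scale1 : left_id 1 galg_scale.
Proof. by move=> T; apply: galg_op_inj; exact: scale1r. Qed.
Let scaleDr : right_distributive galg_scale +%R.
Proof. by move=> a S T; apply: galg_op_inj; exact: scalerDr. Qed.
Let scaleDl (T : L) : {morph galg_scale^~ T : a b / a + b}.
Proof. by move=> a b; apply: galg_op_inj; exact: scalerDl. Qed.

HB.instance Definition _ := GRing.Zmodule_isLmodule.Build K L scaleA scale1 scaleDr scaleDl.

Let scaleAl (a : K) (S T : L) : a *: (S * T) = (a *: S) * T.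
Proof. by apply: galg_op_inj. Qed.

HB.instance Definition _ := GRing.Lmodule_isLalgebra.Build K L scaleAl.
HB.instance Definition _ := GRing.Lalgebra_isComAlgebra.Build K L.

Definition galg_norm (T : L) : R := opnorm (galg_op T).

Lemma galg_ultrametric : ultrametric_algebra galg_norm.
Proof.
have b (T : L) : bounded_op (galg_op T) by exact: gen_alg_bounded (galgP T).
split => [T|T T0||S T|S T|k T|u cu].
- exact: opnorm_ge0.
- by apply: galg_op_inj; exact: opnorm_eq0.
- exact: opnorm_id.
- exact: opnormD.
- exact: opnorm_comp.
- exact: opnormZ.
have [T [bT uT]] := opnorm_complete (fun n => b (u n)) cu.
have LT : gen_alg V T.
  apply: (gen_alg_closed bV bT) => e /uT[n0 H]; exists (galg_op (u n0)); first exact: galgP.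
  by rewrite -opnormN ?opprB ?H//; exact: bounded_sub.
by exists (galg_of LT) => e /uT.
Qed.

Lemma galg_uniform : uniform_alg (gen_alg V) -> uniform_seminorm galg_norm.
Proof.
move=> uV; have uL := galg_ultrametric.
split => [x|||x y|x y|x]; [exact: un_ge0|exact: un0|exact: un1| |exact: unM|exact: uV (galgP x)].
by apply: (unB_le uL); rewrite ?lerDl ?lerDr (un_ge0 uL).
Qed.

End GalgInstances.

(** * The p-adic absolute value *)

(** From the recursion [v(n!) = n/p + v((n/p)!)] for the valuation, where
[3 * (n/p) <= n]. *)
Lemma logn_fact_le p k : prime p -> p <> 2%N -> (2 * logn p k.+1`! <= k)%N.
Proof.
move=> pp p2; have p3 : (2 < p)%N by have := prime_gt1 pp; lia.
have rec n : logn p n`! = (n %/ p + logn p (n %/ p)`!)%N.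
  rewrite !logn_fact//.
  case: n => [|n]; first by rewrite div0n !big_geq.
  have np : (n.+1 %/ p <= n)%N by have := ltn_Pdiv (prime_gt1 pp) (ltn0Sn n); rewrite ltnS.
  rewrite big_nat_recl// expn1; congr (_ + _)%N.
  rewrite (@big_cat_nat _ _ _ (n.+1 %/ p).+1) //=.
  rewrite [X in (_ + X)%N = _]big_nat_cond [X in (_ + X)%N = _]big1 ?addn0.
    by rewrite !big_nat; apply: eq_bigr => i _; rewrite -divnMA expnS.
  move=> i /andP[/andP[hi _] _].
  rewrite expnS divnMA divn_small//; apply: (leq_trans hi).
  by apply: ltnW; exact: ltn_expl (prime_gt1 pp).
elim/ltn_ind: k => k IH; rewrite rec.
have [q0|q0] := posnP (k.+1 %/ p); first by rewrite q0 fact0 logn1.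
have qk : ((k.+1 %/ p).-1 < k)%N.
  have := ltn_Pdiv (prime_gt1 pp) (ltn0Sn k); lia.
have := IH _ qk; rewrite prednK// => H.
have := leq_trunc_div k.+1 p; nia.
Qed.

Section PadicAbs.
Variables (R : realType) (p : nat).
Hypotheses (p_prime : prime p) (p_neq2 : p <> 2%N).
Variable K : nonArchFieldType R.
Hypothesis K_ext : forall q : rat, vabs (ratr q : K) = padic_abs R p q.

Let p_gt0 : 0 < p%:R :> R.
Proof. by rewrite ltr0n prime_gt0. Qed.

Lemma vabs_nat n : (0 < n)%N -> vabs (n%:R : K) = (p%:R^-1) ^+ logn p n.
Proof.
move=> n0; rewrite -(ratr_nat K n) K_ext /padic_abs.
have -> : (n%:R == 0 :> rat) = false by rewrite pnatr_eq0; case: n n0.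
rewrite -[n%:R]/(n%:Z%:~R) numq_int denq_int /= logn1 sub0r.
by rewrite exprVn -exprnN.
Qed.

(** The square root of the absolute value of [p]; its powers bound the absolute
values of factorials from below, as [p] is odd (lemma [root_abs_fact]). *)
Definition root_abs : R := Num.sqrt p%:R^-1.
Local Notation t := root_abs.

Lemma root_abs_gt0 : 0 < t.
Proof. by rewrite sqrtr_gt0 invr_gt0. Qed.

Lemma root_abs_sqr : t ^+ 2 = p%:R^-1.
Proof. by rewrite sqr_sqrtr// invr_ge0 ltW. Qed.

Lemma root_abs_lt1 : t < 1.
Proof.
rewrite -(@ltr_pXn2r _ 2) ?nnegrE ?(ltW root_abs_gt0)// root_abs_sqr expr1n.
by rewrite invf_lt1// ltr1n prime_gt1.
Qed.

Lemma vabs_p : vabs (p%:R : K) = t ^+ 2.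
Proof. by rewrite vabs_nat ?prime_gt0// logn_prime// eqxx expr1 root_abs_sqr. Qed.

Lemma root_abs_fact k : t ^+ k <= vabs (k.+1`!%:R : K).
Proof.
rewrite vabs_nat ?fact_gt0// -root_abs_sqr -exprM.
apply: ler_wiXn2l; rewrite ?(ltW root_abs_gt0) ?(ltW root_abs_lt1)//.
exact: logn_fact_le.
Qed.

Lemma vabs_nat_le1 n : vabs (n%:R : K) <= 1.
Proof.
case: n => [|n]; first by rewrite vabs0.
by rewrite vabs_nat// exprn_ile1 ?invr_ge0 ?invf_le1 ?(ltW p_gt0)// ler1n prime_gt0.
Qed.

Lemma vabs_int_le1 (m : int) : vabs (m%:~R : K) <= 1.
Proof.
case: m => n; first exact: vabs_nat_le1.
by rewrite NegzE mulrNz vabsN vabs_nat_le1.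
Qed.

Lemma natr_neq0 n : (0 < n)%N -> (n%:R : K) != 0.
Proof.
move=> n0; rewrite -(@vabs_eq0 R) vabs_nat//.
by rewrite expf_neq0// invr_eq0 gt_eqF.
Qed.

Lemma intr_neq0 (m : int) : m != 0 -> (m%:~R : K) != 0.
Proof.
case: m => n n0; first by apply: natr_neq0; rewrite lt0n.
by rewrite NegzE mulrNz oppr_eq0 natr_neq0.
Qed.

(** As [K] has characteristic zero, [ratr x] may be computed from any fraction
equal to [x]. *)
Lemma ratr_frac (x : rat) (m d : int) : x * d%:~R = m%:~R -> (ratr x : K) * d%:~R = m%:~R.
Proof.
move=> E; have d0 := intr_neq0 (denq_neq0 x).
rewrite /ratr mulrAC; apply: (canLR (mulfK d0)); rewrite -!intrM; congr (_%:~R).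
apply: (@intr_inj rat); rewrite !intrM -E mulrAC; congr (_ * _).
by rewrite -{2}(divq_num_den x) divfK// intr_eq0 denq_neq0.
Qed.

Let ratr_den (x : rat) : (ratr x : K) * (denq x)%:~R = (numq x)%:~R.
Proof. by rewrite /ratr divfK// intr_neq0// denq_neq0. Qed.

Let rat_den (x : rat) : x * (denq x)%:~R = (numq x)%:~R.
Proof. by rewrite -{1}(divq_num_den x) divfK// intr_eq0 denq_neq0. Qed.

Lemma ratrB x y : ratr (x - y) = ratr x - ratr y :> K.
Proof.
have d0 : ((denq x * denq y)%:~R : K) != 0 by rewrite intr_neq0// mulf_neq0 ?denq_neq0.
apply: (mulIf d0).
rewrite (@ratr_frac _ (numq x * denq y - numq y * denq x)).
  by rewrite !(intrB, intrM) -!ratr_den; ring.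
by rewrite !(intrB, intrM) -!rat_den; ring.
Qed.

Lemma ratrM x y : ratr (x * y) = ratr x * ratr y :> K.
Proof.
have d0 : ((denq x * denq y)%:~R : K) != 0 by rewrite intr_neq0// mulf_neq0 ?denq_neq0.
apply: (mulIf d0).
rewrite (@ratr_frac _ (numq x * numq y)).
  by rewrite !intrM -!ratr_den; ring.
by rewrite !intrM -!rat_den; ring.
Qed.

Lemma ratrV x : ratr x^-1 = (ratr x)^-1 :> K.
Proof.
have [->|x0] := eqVneq x 0; first by rewrite invr0 /ratr mul0r invr0.
have E : ratr x * ratr x^-1 = 1 :> K by rewrite -ratrM divff// /ratr divr1.
have rx0 : (ratr x : K) != 0.
  by apply/eqP => rx0; move: E; rewrite rx0 mul0r => /esym/eqP; rewrite oner_eq0.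
by apply: (mulfI rx0); rewrite E divff.
Qed.

(** ** The field of p-adic numbers inside [K] *)

Lemma ball_vabs (x y : K) (e : R) : ball x e y = (vabs (x - y) < e).
Proof. by rewrite ballEmdist. Qed.

Lemma padic_numP (x : K) :
  padic_num K x <-> forall e, 0 < e -> exists q, vabs (x - ratr q) < e.
Proof.
split=> [H e e0|H A /nbhs_ballP[e /= e0 eA]].
  have [_ [[q _ <-]]] := H _ (nbhsx_ballx x e e0); rewrite ball_vabs => h.
  by exists q.
have [q xq] := H e e0; exists (ratr q); split; first by exists q.
by apply: eA; rewrite ball_vabs.
Qed.

Lemma regular_ultrametric : @ultrametric_algebra R K K^o (@vabs R K).
Proof.
split; [exact: vabs_ge0| |exact: vabs1|exact: vabs_ultra| | |exact: vabs_complete].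
- by move=> x /eqP; rewrite vabs_eq0 => /eqP.
- by move=> x y; rewrite vabsM.
- by move=> k x; rewrite -vabsM.
Qed.
Local Notation uK := regular_ultrametric.

Lemma padic_num_rat q : padic_num K (ratr q).
Proof. by apply/padic_numP => e e0; exists q; rewrite subrr vabs0. Qed.

Lemma padic_num_nat n : padic_num K n%:R.
Proof. by rewrite -(ratr_nat K n); exact: padic_num_rat. Qed.

Lemma padic_num0 : padic_num K 0.
Proof. by rewrite -(mulr0n 1); exact: padic_num_nat. Qed.

Lemma padic_num_closed : norm_closed (@vabs R K) (padic_num K).
Proof.
move=> u l Pu ul; apply/padic_numP => e e0; have [n0 H] := ul e e0.
have [q hq] := (padic_numP (u n0)).1 (Pu n0) e e0.
exists q; have -> : l - ratr q = - (u n0 - l) + (u n0 - ratr q) by rewrite opprB addrA subrK.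
by apply: (unD_lt uK) => //; rewrite vabsN H.
Qed.

Lemma padic_numB x y : padic_num K x -> padic_num K y -> padic_num K (x - y).
Proof.
move=> /padic_numP Px /padic_numP Py; apply/padic_numP => e e0.
have [q hq] := Px e e0; have [r hr] := Py e e0; exists (q - r).
have -> : x - y - ratr (q - r) = (x - ratr q) - (y - ratr r) by rewrite ratrB; ring.
by apply: (unD_lt uK) => //; rewrite vabsN.
Qed.

Lemma padic_num_seq x : padic_num K x ->
  exists q : nat -> rat, norm_cvg (@vabs R K) (fun n => ratr (q n)) x.
Proof.
move=> /padic_numP Px.
have /choice[q Hq] n : exists q, vabs (x - ratr q) < n.+1%:R^-1 by apply: Px; rewrite invr_gt0.
exists q => e e0; have [n0 _ H] := near_infty_natSinv_lt (PosNum e0).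
exists n0 => n /H /= h; rewrite -vabsN opprB; exact: lt_trans (Hq n) h.
Qed.

Lemma padic_numM x y : padic_num K x -> padic_num K y -> padic_num K (x * y).
Proof.
move=> /padic_num_seq[q qx] /padic_num_seq[r ry].
apply: padic_num_closed (un_cvgM uK qx ry) => n.
by rewrite -ratrM; exact: padic_num_rat.
Qed.

Lemma padic_numN x : padic_num K x -> padic_num K (- x).
Proof. by rewrite -sub0r; apply: padic_numB; exact: padic_num0. Qed.

Lemma padic_numD x y : padic_num K x -> padic_num K y -> padic_num K (x + y).
Proof. by move=> Px Py; rewrite -[y]opprK; apply: padic_numB => //; exact: padic_numN. Qed.

Lemma padic_numX x n : padic_num K x -> padic_num K (x ^+ n).
Proof.
move=> Px; elim: n => [|n IH]; first by rewrite expr0 -(mulr1n 1); exact: padic_num_nat.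
by rewrite exprS; exact: padic_numM.
Qed.

Lemma padic_numV x : padic_num K x -> padic_num K x^-1.
Proof.
move=> Px; have [->|x0] := eqVneq x 0; first by rewrite invr0; exact: padic_num0.
have vx : 0 < vabs x by rewrite lt_def vabs_eq0 x0 vabs_ge0.
move/padic_numP : Px => Px; apply/padic_numP => e e0.
have d0 : 0 < Num.min (vabs x) (e * vabs x ^+ 2) by rewrite lt_min vx mulr_gt0 ?exprn_gt0.
have [q] := Px _ d0; rewrite lt_min => /andP[h1 h2]; exists q^-1.
have vq : vabs x <= vabs (ratr q : K).
  rewrite leNgt; apply/negP => lt.
  have := unD_lt uK h1 lt; rewrite subrK ltxx; exact/negP.
have q0 : (ratr q : K) != 0 by rewrite -(@vabs_eq0 R) gt_eqF// (lt_le_trans vx).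
rewrite ratrV; have -> : x^-1 - (ratr q)^-1 = - (x - ratr q) / (x * ratr q).
  by field; rewrite x0 q0.
rewrite vabsM vabsN vabsV; last by rewrite mulf_neq0.
rewrite vabsM ltr_pdivrMr ?mulr_gt0 ?(lt_le_trans vx)//.
by rewrite (lt_le_trans h2)// ler_wpM2l ?(ltW e0)// expr2 ler_wpM2l ?(ltW vx).
Qed.

Lemma padic_intM x y : padic_int K x -> padic_int K y -> padic_int K (x * y).
Proof.
move=> [Px x1] [Py y1]; split; first exact: padic_numM.
by rewrite vabsM mulr_ile1 ?vabs_ge0.
Qed.

Lemma padic_int_nat n : padic_int K n%:R.
Proof. by split; [exact: padic_num_nat|exact: vabs_nat_le1]. Qed.

(** An approximating rational in the unit ball has a denominator prime to [p], so
it is congruent to an integer modulo any power of [p]; adding a multiple of that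
power makes the integer positive. *)
Lemma padic_int_dense z e : padic_int K z -> 0 < e ->
  exists2 n, (0 < n)%N & vabs (n%:R - z) < e.
Proof.
clear p_neq2; move=> [Pz z1] e0.
have m0 : 0 < Num.min e 1 by rewrite lt_min e0 ltr01.
have [q] := (padic_numP z).1 Pz _ m0; rewrite lt_min => /andP[zqe zq1].
have q1 : vabs (ratr q : K) <= 1.
  have -> : ratr q = z - (z - ratr q) :> K by rewrite opprB addrC subrK.
  by apply: (unB_le uK) => //; exact: ltW.
have pden : coprime p `|denq q|.
  rewrite prime_coprime//; apply/negP => pd.
  have pn : ~~ (p %| `|numq q|)%N.
    apply/negP => pn; have := coprime_num_den q.
    rewrite /coprime => /eqP g1; have : (p %| 1)%N by rewrite -g1 dvdn_gcd pn pd.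
    by rewrite dvdn1 => /eqP p1; move: p_prime; rewrite p1.
  have qn0 : q != 0 by apply: contraNneq pn => ->; exact: dvdn0.
  have l0 : logn p `|numq q| = 0%N by rewrite lognE (negbTE pn) !andbF.
  move: q1; rewrite K_ext /padic_abs (negbTE qn0) l0 subr0.
  rewrite leNgt => /negP; apply.
  by rewrite -exprnP exprn_egt1 ?ltr1n ?prime_gt1// -lt0n logn_gt0 mem_primes
    p_prime pd absz_gt0 denq_neq0.
have [k pk] : exists k, (p%:R^-1 : R) ^+ k < e.
  have [|n0 H] := @geometric_small R 1 p%:R^-1 e _ e0.
    by rewrite invr_ge0 (ltW p_gt0) invf_lt1// ltr1n prime_gt1.
  by exists n0; rewrite -[ltLHS]mul1r H.
(* [a * u] is congruent to [q] modulo [p ^ k]; adding [s * p ^ k] makes it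
positive. *)
have [[u v] /= uv] : exists uv : int * int, uv.1 * denq q + uv.2 * (p ^ k)%N%:Z = 1.
  by apply/coprimezP; rewrite coprimezE coprime_sym coprimeXl.
pose a := numq q; pose m : int := a * u; pose s : int := `|m|%N%:Z + 1.
pose n := absz (m + s * (p ^ k)%N%:Z).
have pk0 : (0 < p ^ k)%N by rewrite expn_gt0 prime_gt0.
have w0 : 0 < m + s * (p ^ k)%N%:Z by rewrite /s; nia.
have nE : n%:Z = m + s * (p ^ k)%N%:Z by rewrite /n gez0_abs// ltW.
exists n; first by rewrite absz_gt0 gt_eqF.
have -> : n%:R - z = (n%:R - ratr q) - (z - ratr q) by ring.
apply: (unD_lt uK); last by rewrite vabsN.
have d1 : vabs ((denq q)%:~R : K) = 1.
  rewrite -absz_denq -[LHS]/(vabs (`|denq q|%:R : K)) vabs_nat ?absz_gt0 ?denq_neq0//.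
  by rewrite logn_coprime// expr0.
have -> : vabs (n%:R - ratr q : K) = vabs ((n%:R - ratr q) * (denq q)%:~R : K).
  by rewrite vabsM d1 mulr1.
rewrite mulrBl ratr_den -[n%:R]/(n%:Z%:~R) -intrM -intrB nE.
have -> : (m + s * (p ^ k)%N%:Z) * denq q - numq q =
    (p ^ k)%N%:Z * (s * denq q - a * v).
  have uE : u * denq q = 1 - v * (p ^ k)%N%:Z by rewrite -uv addrK.
  by rewrite mulrDl /m -(mulrA a) uE -/a; ring.
rewrite intrM vabsM (le_lt_trans _ pk)// -[leRHS]mulr1 ler_pM ?vabs_ge0 ?vabs_int_le1//.
by rewrite -[X in vabs X]/((p ^ k)%:R : K) vabs_nat ?expn_gt0 ?prime_gt0// pfactorK.
Qed.

End PadicAbs.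

(** * The p-adic exponential and logarithm *)

Lemma norm_cvg_lim (R : realType) (K : nonArchFieldType R) (u : nat -> K) (l : K) :
  norm_cvg (@vabs R K) u l -> limn u = l.
Proof.
move=> ul; apply: cvg_lim; first exact: metric_hausdorff.
apply/cvg_ballP => e e0; have [n0 H] := ul e e0.
exists n0 => // n /= /H; by rewrite ball_vabs -vabsN opprB.
Qed.

Section PadicExp.
Variables (R : realType) (p : nat).
Hypotheses (p_prime : prime p) (p_neq2 : p <> 2%N).
Variable K : nonArchFieldType R.
Hypothesis K_ext : forall q : rat, vabs (ratr q : K) = padic_abs R p q.

Local Notation t := (root_abs R p).
Local Notation uK := (@regular_ultrametric R K).
Let t_gt0 : 0 < t := root_abs_gt0 R p_prime.
Let t_lt1 : t < 1 := root_abs_lt1 R p_prime.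
Let fact_ge k : t ^+ k <= vabs (k.+1`!%:R : K) := root_abs_fact p_prime p_neq2 K_ext k.
Let numB (x y : K) := @padic_numB R p p_prime K K_ext x y.
Let numD (x y : K) := @padic_numD R p p_prime K K_ext x y.
Let numM (x y : K) := @padic_numM R p p_prime K K_ext x y.
Let numX (x : K) n := @padic_numX R p p_prime K K_ext x n.
Let numV (x : K) := @padic_numV R p p_prime K K_ext x.
Let numN (x : K) := @padic_numN R p p_prime K K_ext x.
Let num1 : padic_num K 1.
Proof. by rewrite -(mulr1n 1); exact: padic_num_nat. Qed.
Let kexp := @alg_exp R K K^o (@vabs R K).

Lemma pexpE (x : K) : vabs x <= t ^+ 2 -> pexp x = kexp x.
Proof.
move=> xt; apply: norm_cvg_lim; have := alg_expP uK t_gt0 t_lt1 fact_ge xt.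
congr norm_cvg; apply/funext => n; rewrite /exp_sum seriesEord /=.
by apply: eq_bigr => k _; rewrite /exp_term mulrC.
Qed.

Lemma pexp_isometry (x y : K) : vabs x <= t ^+ 2 -> vabs y <= t ^+ 2 ->
  vabs (pexp x - pexp y) = vabs (x - y).
Proof.
move=> xt yt; rewrite !pexpE//.
exact: (alg_exp_isometry uK t_gt0 t_lt1 fact_ge xt yt).
Qed.

Lemma alg_exp_scalar (A : comAlgType K) (N : A -> R) (k : K) : ultrametric_algebra N ->
  vabs k <= t ^+ 2 -> alg_exp N k%:A = (pexp k)%:A.
Proof.
move=> uN kt; apply: (alg_expE uN) => e e0; rewrite pexpE//.
have [n0 H] := alg_expP uK t_gt0 t_lt1 fact_ge kt e0.
exists n0 => n /H; congr (_ < e).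
rewrite -[LHS](un_scalar uN) scalerBl; congr (N (_ - _)).
have powE j : (k%:A : A) ^+ j = (k ^+ j)%:A.
  elim: j => [|j IH]; first by rewrite !expr0 scale1r.
  by rewrite !exprS IH -scalerAl mul1r scalerA.
rewrite /exp_sum scaler_suml; apply: eq_bigr => i _.
by rewrite /exp_term powE scalerA.
Qed.

(** The fixed point defining the inverse of the exponential may be sought among
the p-adic numbers. *)
Lemma pexp_padic_onto (y : K) : padic_num K y -> vabs y <= t ^+ 2 ->
  exists x, [/\ padic_num K x, vabs x <= t ^+ 2 & pexp x = 1 + y].
Proof.
move=> Py yt; pose S : set K := [set x | padic_num K x /\ vabs x <= t ^+ 2].
have [||||x [Px xt] E] := @alg_exp_onto R K K^o (@vabs R K) uK t t_gt0 t_lt1 fact_ge S y.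
- move=> u l Su ul; split.
    by apply: padic_num_closed ul => n; case: (Su n).
  by apply: (exp_ball_closed uK (t := t)) ul => n; case: (Su n).
- by move=> x [].
- by split; [exact: padic_num0|rewrite vabs0 exprn_ge0// ltW].
- move=> x [Px xt]; rewrite -/kexp; split; last first.
    have := alg_exp_approx uK t_gt0 t_lt1 fact_ge xt (y := 0).
    rewrite (alg_exp0 uK) (un0 uK) !subrr !subr0 => H.
    apply: (unB_le uK) => //; apply: (le_trans (H _)); first by rewrite exprn_ge0// ltW.
    by rewrite (le_trans _ xt)// ler_piMl ?vabs_ge0// ltW.
  apply: numB => //; apply: numB => //; apply: numB => //.
  apply: padic_num_closed (alg_expP uK t_gt0 t_lt1 fact_ge xt) => n.
  rewrite /exp_sum; elim: n => [|n IH]; first by rewrite big_ord0; exact: padic_num0.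
  rewrite big_ord_recr /=; apply: numD => //; apply: numM; last exact: numX.
  by apply: numV; exact: padic_num_nat.
by exists x; split => //; rewrite pexpE.
Qed.

(** The logarithmic series of [1 + p%:R] has the leading term [p%:R], and its other
terms are smaller. *)
Lemma plog_unit : let c := p%:R^-1 * plog (1 + p%:R : K) in padic_int K c /\ vabs c = 1.
Proof.
have pt := vabs_p p_prime K_ext.
have p0 : (p%:R : K) != 0 by apply: (natr_neq0 p_prime K_ext); exact: prime_gt0.
pose a n : K := (-1) ^+ n * (1 + p%:R - 1) ^+ n.+1 / n.+1%:R.
have a0 : a 0 = p%:R by rewrite /a expr0 mul1r expr1 addrC addKr divr1.
have aS n : vabs (a n.+1) <= t ^+ 3 * t ^+ n.
  (* [n.+2] divides its factorial, so it is not smaller in absolute value. *)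
  have nn : t ^+ n.+1 <= vabs (n.+2%:R : K).
    apply: (le_trans (fact_ge _)); rewrite factS natrM vabsM ler_piMr ?vabs_ge0//.
    exact: (vabs_nat_le1 p_prime K_ext).
  have n0 : (n.+2%:R : K) != 0 by exact: (natr_neq0 p_prime K_ext).
  rewrite /a [1 + _]addrC addrK vabsM vabsM vabsV// !vabsX vabsN vabs1 expr1n mul1r pt.
  rewrite ler_pdivrMr ?(lt_le_trans _ nn) ?exprn_gt0//.
  have -> : (t ^+ 2) ^+ n.+2 = t ^+ 3 * t ^+ n * t ^+ n.+1.
    by rewrite -exprM -!exprD; congr (t ^+ _); lia.
  by rewrite ler_wpM2l// mulr_ge0 ?exprn_ge0// ltW.
pose u n := series a n.
have Pu n : padic_num K (u n).
  rewrite /u seriesEord; elim: n => [|n IH] /=; first by rewrite big_ord0; exact: padic_num0.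
  rewrite big_ord_recr /=; apply: numD => //; apply: numM; last first.
    by apply: numV; exact: padic_num_nat.
  apply: numM; apply: numX; first exact: numN.
  by rewrite addrC addKr; exact: padic_num_nat.
have [l ul] : exists l, norm_cvg (@vabs R K) (fun n => u n.+1) l.
  apply: (un_cvg_step uK (t := t) (C := t ^+ 3)); rewrite ?exprn_ge0 ?(ltW t_gt0)//.
  by move=> n; rewrite /u /series /= big_nat_recr//= addrC addrK aS.
have lE : plog (1 + p%:R) = l.
  apply: norm_cvg_lim => e /ul[n0 H]; exists n0.+1 => -[//|n]; exact: H.
have Pl : padic_num K l by apply: padic_num_closed ul => n.
have lp : vabs (l - p%:R) <= t ^+ 3.
  apply: (un_cvg_bound (n0 := 0) uK ul) => n _.
  rewrite /u seriesEord /= big_ord_recl a0 addrC addKr.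
  apply: (un_sum uK) => [|i _]; first by rewrite exprn_ge0// ltW.
  by rewrite (le_trans (aS _))// ler_piMr ?exprn_ge0 ?exprn_ile1 ?(ltW t_gt0) ?(ltW t_lt1).
have lt : vabs l = t ^+ 2.
  have lp2 : vabs (l - p%:R) < t ^+ 2.
    by rewrite (le_lt_trans lp)// exprS gtr_pMl// exprn_gt0.
  apply/eqP; rewrite eq_le; apply/andP; split.
    by rewrite -[l](subrK p%:R); apply: (unD_le uK); [exact: ltW|rewrite pt].
  rewrite leNgt; apply/negP => lt.
  have : vabs (p%:R : K) < t ^+ 2.
    rewrite -[p%:R](subKr l) opprB addrC -opprB; apply: (unD_lt uK) => //.
    by rewrite vabsN.
  by rewrite pt ltxx.
rewrite lE /=; have vc : vabs (p%:R^-1 * l) = 1.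
  by rewrite vabsM vabsV// pt lt mulVf// expf_neq0// gt_eqF.
split=> //; split; last by rewrite vc.
by apply: numM => //; apply: numV; exact: padic_num_nat.
Qed.

End PadicExp.

(** * Gelfand theory of the generated algebra *)

Section Gelfand.
Variables (R : realType) (K : nonArchFieldType R) (B : nonArchBanachType K).
Variables (V : B -> B) (bV : bounded_op V) (nt : exists x : B, x != 0).
Local Notation L := (galg bV nt).
Local Notation N := (@galg_norm R K B V bV nt).
Let uN : ultrametric_algebra N := galg_ultrametric bV nt.

Section Seminorm.
Variable x : L -> R.
Hypothesis sx : @mult_seminorm R K B (gen_alg V) x.

Lemma seminormM (S T : L) : x (S * T) = x S * x T.
Proof. exact: (msnM sx (S := S) (T := T) (U := S * T)). Qed.

Lemma seminormB (S T : L) : x (S - T) <= x S + x T.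
Proof. exact: (msnB sx (S := S) (T := T) (U := S - T)). Qed.

Lemma seminorm1 : x 1 = 1.
Proof. exact: (msn1 sx (T := (1 : L))). Qed.

Lemma seminorm_ge0 (T : L) : 0 <= x T.
Proof. exact: (msn_ge0 sx). Qed.

Lemma seminorm_unit (S T : L) : S * T = 1 -> x S <> 0.
Proof.
move=> ST S0; have := seminorm1; rewrite -ST seminormM S0 mul0r => /esym/eqP.
by rewrite oner_eq0.
Qed.

Lemma gelfand_valueE (a : L) k : gelfand_value x (galg_op a) k <-> x (a - k%:A) = 0.
Proof.
split=> [[D DE xD]|xa]; last by exists (a - k%:A).
by rewrite (_ : a - k%:A = D)//; apply: galg_op_inj.
Qed.

End Seminorm.

Hypothesis uniV : uniform_alg (gen_alg V).

Lemma berkovich_attained (T : L) : 0 < N T ->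
  exists x : L -> R, [/\ berkovich (gen_alg V) x, x T = N T & forall S, x S <= N S].
Proof.
move=> T0; have [x [ux xM xle xT]] := uniform_norm_attained (galg_uniform bV nt uniV) T0.
exists x; split => //; split.
- exact: usn_ge0 ux.
- by move=> S S0; rewrite (_ : S = 0 :> L) ?(usn0 ux)//; exact: val_inj.
- by move=> S S1; rewrite (_ : S = 1 :> L) ?(usn1 ux)//; exact: val_inj.
- by move=> S Q U UE; rewrite (_ : U = (S : L) - (Q : L) :> L) ?(usnB ux)//; exact: val_inj.
- by move=> S Q U UE; rewrite (_ : U = (S : L) * (Q : L) :> L) ?xM//; exact: val_inj.
- by exists 1 => S; rewrite mul1r; exact: xle.
Qed.

(** The seminorm attaining the norm of the difference vanishes there. *)
Lemma berkovich_separates (S T : L) :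
  (forall x : L -> R, berkovich (gen_alg V) x -> x (S - T) = 0) -> S = T.
Proof.
move=> H; apply/eqP; rewrite -subr_eq0; apply/eqP/(un_eq0 uN)/eqP; apply: contrapT => ST.
have [|x [bx xE _]] := @berkovich_attained (S - T).
  by rewrite lt_def (un_ge0 uN) andbT; apply/negP.
by apply: ST; rewrite -xE (H x bx).
Qed.

(** ** Invertibility and the spectrum *)

Definition invertible_op (S : B -> B) :=
  exists T, [/\ bounded_op T, T \o S = idfun & S \o T = idfun].

Lemma invertible_comp S T : invertible_op S -> invertible_op T -> invertible_op (S \o T).
Proof.
move=> [S' [bS S'S SS']] [T' [bT T'T TT']]; exists (T' \o S'); split.
- exact: bounded_comp.
- by change (T' \o (S' \o S) \o T = idfun); rewrite S'S.
- by change (S \o (T \o T') \o S' = idfun); rewrite TT'.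
Qed.

Lemma galg_invertible (S T : L) : S * T = 1 -> invertible_op (galg_op S).
Proof.
move=> ST; exists (galg_op T); split; first exact: gen_alg_bounded (galgP T).
  by have := congr1 (@galg_op _ _ _ _ _ _) ST; rewrite mulrC.
exact: (congr1 (@galg_op _ _ _ _ _ _) ST).
Qed.

Lemma invertible_unit_mul (S G G' : L) : G * G' = 1 ->
  invertible_op (galg_op (S * G)) <-> invertible_op (galg_op S).
Proof.
move=> GG'; have iG := galg_invertible GG'.
have iG' : invertible_op (galg_op G') by apply: (@galg_invertible _ G); rewrite mulrC.
split=> [H|H]; last exact: (invertible_comp H iG).
have -> : S = S * G * G' by rewrite -mulrA GG' mulr1.
exact: (invertible_comp H iG').
Qed.

(** Up to the scalar [- l], the element [a - l] is a perturbation of [1]. *)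
Lemma unit_large (a : L) l : N a <= 1 -> 1 < vabs l -> exists b : L, (a - l%:A) * b = 1.
Proof.
move=> a1 l1; have l0 : l != 0 by rewrite -(@vabs_eq0 R) gt_eqF// (lt_trans ltr01).
have [|b bE] := @add1_invertible R K _ N uN (- (l^-1 *: a)).
  rewrite (unN uN) (unZ uN) vabsV// (le_lt_trans (y := (vabs l)^-1))//.
    by rewrite ler_piMr// invr_ge0 vabs_ge0.
  by rewrite invf_lt1// (lt_trans ltr01).
exists ((- l^-1) *: b); rewrite -[RHS]bE.
have -> : (a - l%:A) * ((- l^-1) *: b) = ((- l^-1) *: (a - l%:A)) * b.
  by rewrite -scalerAr scalerAl.
by congr (_ * b); rewrite scalerBr scalerA mulNr mulVf// !scaleNr scale1r opprK addrC.
Qed.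

End Gelfand.

Lemma nontrivial_of_spectrum (R : realType) (K : nonArchFieldType R) (B : nonArchBanachType K)
  (V : B -> B) : spectrum V !=set0 -> exists x : B, x != 0.
Proof.
move=> [l Hl]; apply: contrapT => H; apply: Hl.
have E (x y : B) : x = y.
  have z (u : B) : u = 0 by apply: contrapT => /eqP u0; apply: H; exists u.
  by rewrite (z x) (z y).
exists idfun; split; [exact: bounded_id|apply/funext => x; exact: E|apply/funext => x; exact: E].
Qed.

(** * Transport of homeomorphisms *)

Lemma continuous_on_comp (X Y Z : topologicalType) (M : set X) (P : set Y)
    (h : X -> Y) (g : Y -> Z) : set_fun M P h ->
  {within M, continuous h} -> {within P, continuous g} -> {within M, continuous (g \o h)}.
Proof.
move=> MP /subspace_continuousP ch /subspace_continuousP cg.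
apply/subspace_continuousP => x Mx U /= Ug.
have H : nbhs x [set y | M y -> P (h y) -> U (g (h y))] :=
  ch x Mx _ (cg _ (MP _ Mx) U Ug).
change (nbhs x [set y | M y -> U (g (h y))]).
by apply: filterS H => y H My; exact: H My (MP _ My).
Qed.

Lemma homeo_on_comp (X Y Z : topologicalType) (M : set X) (P : set Y) (Q : set Z)
    (h : X -> Y) (f : Y -> Z) (e : Z -> Y) :
  homeo_on M P h -> set_bij P Q f -> set_fun Q P e -> {in P, cancel f e} ->
  {within P, continuous f} -> {within Q, continuous e} -> homeo_on M Q (f \o h).
Proof.
move=> [bh ch [g gK cg]] bf QP fK cf ce.
have MP : set_fun M P h by case: bh.
split; [exact: set_bij_comp bh bf|exact: continuous_on_comp MP ch cf|].
exists (g \o e); last exact: continuous_on_comp QP ce cg.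
move=> x; rewrite inE => Mx /=; rewrite fK ?inE; last exact: MP.
by rewrite gK ?inE.
Qed.

Section Scaling.
Variables (R : realType) (K : nonArchFieldType R).

Lemma scaling_continuous (P : set K) (f : K -> K) (r : R) :
  (forall x y, P x -> P y -> vabs (f x - f y) <= r * vabs (x - y)) -> {within P, continuous f}.
Proof.
move=> H; apply/subspace_continuousP => x Px U /nbhs_ballP[e /= e0 eU].
have d0 : 0 < e / (`|r| + 1) by rewrite divr_gt0// ltr_wpDl.
rewrite /within /= near_simpl; apply/nbhs_ballP; exists (e / (`|r| + 1)) => //= y.
rewrite ball_vabs => xy Py; apply: eU; rewrite ball_vabs.
apply: le_lt_trans (H _ _ Px Py) _.
apply: (@le_lt_trans _ _ ((`|r| + 1) * vabs (x - y))).
  by rewrite ler_wpM2r ?vabs_ge0// (le_trans (ler_norm _))// lerDl.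
by rewrite mulrC -ltr_pdivlMr// ltr_wpDl.
Qed.

(** An injective continuous map sends a component into a component, hence to a
single point. *)
Lemma totally_disconnected_inj (P Q : set K) (e : K -> K) : set_fun Q P e -> set_inj Q e ->
  {within Q, continuous e} -> totally_disconnected P -> totally_disconnected Q.
Proof.
move=> QP einj ce tP x Qx; apply/seteqP; split => [y|_ ->]; last exact: connected_component_refl.
set C := connected_component Q x => Cy.
have Cx : C x by exact: connected_component_refl.
have CQ : C `<=` Q by exact: connected_component_sub.
have cC : connected C by exact: component_connected.
have eC : connected (e @` C).
  by apply: connected_continuous_connected => //; exact: continuous_subspaceW ce.
have /(_ (e y)) : e @` C `<=` connected_component P (e x).
  apply: connected_component_max; [by exists x| |exact: eC].
  by move=> _ [z Cz <-]; exact/QP/CQ.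
rewrite (tP _ (QP _ Qx)) => H.
apply: einj; rewrite ?inE//; first exact: CQ.
by apply: H; exists y.
Qed.

End Scaling.

(** * The infinitesimal generator *)

Section Generator.
Variables (R : realType) (p : nat).
Hypotheses (p_prime : prime p) (p_neq2 : p <> 2%N).
Variable K : nonArchFieldType R.
Hypothesis K_ext : forall q : rat, vabs (ratr q : K) = padic_abs R p q.
Variables (B : nonArchBanachType K) (V : B -> B).
Hypotheses (snV : strongly_normal V) (specV : spectrum V `<=` [set p%:R * y | y in padic_int K]).
Variable c : K.
Hypotheses (c_int : padic_int K c) (c_unit : vabs c = 1).

Local Notation t := (root_abs R p).
Let t_gt0 : 0 < t := root_abs_gt0 R p_prime.
Let t_lt1 : t < 1 := root_abs_lt1 R p_prime.
Let fact_ge k : t ^+ k <= vabs (k.+1`!%:R : K) := root_abs_fact p_prime p_neq2 K_ext k.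
Let pt : vabs (p%:R : K) = t ^+ 2 := vabs_p p_prime K_ext.

Let bV : bounded_op V. Proof. by have [[]] := snV. Qed.
Let nt : exists x : B, x != 0.
Proof. by have [_ s0 _ _ _] := snV; exact: nontrivial_of_spectrum s0. Qed.
Let uniV : uniform_alg (gen_alg V). Proof. by have [[]] := snV. Qed.

Local Notation L := (galg bV nt).
Local Notation N := (@galg_norm R K B V bV nt).
Let uN : ultrametric_algebra N := galg_ultrametric bV nt.
Local Notation lexp := (alg_exp N).
Let q : K := p%:R * c.

Lemma vabs_pmul z : padic_int K z -> vabs (p%:R * z) <= t ^+ 2.
Proof. by move=> [_ z1]; rewrite vabsM pt ler_piMr// exprn_ge0// ltW. Qed.

Let vq : vabs q = t ^+ 2. Proof. by rewrite vabsM pt c_unit mulr1. Qed.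
Let q_neq0 : q != 0. Proof. by rewrite -(@vabs_eq0 R) vq expf_neq0// gt_eqF. Qed.

Definition galg_self : L := galg_of bV nt (gen_alg_self bV).
Let v := galg_self.

(** The norm of [V] is its value at some point of the Berkovich spectrum, hence
the absolute value of a point of [spectrum V]. *)
Lemma galg_self_norm : N v <= t ^+ 2.
Proof.
have [v0|v0] := eqVneq (N v) 0; first by rewrite v0 exprn_ge0// ltW.
have [|x [bx xv xle]] := @berkovich_attained R K B V bV nt uniV v.
  by rewrite lt_def v0 (un_ge0 uN).
have [_ _ _ _ [h [[hbij _ _] hval]]] := snV.
have [y yint yE] : [set p%:R * y | y in padic_int K] (h x).
  by apply: specV; have [hfun _ _] := hbij; exact: hfun.
have /(gelfand_valueE (bV := bV) (nt := nt) x v) E := hval x bx.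
rewrite -xv. 
have := seminormB bx (v - (h x)%:A) (- (h x)%:A); rewrite opprK subrK E add0r.
move=> /le_trans; apply; apply: (le_trans (xle _)).
by rewrite (unN uN) (un_scalar uN) -yE vabs_pmul.
Qed.

Lemma exists_log : exists2 y : L, N y <= t ^+ 2 & lexp y = 1 + v.
Proof. exact: (alg_exp_ball_onto uN t_gt0 t_lt1 fact_ge galg_self_norm). Qed.

Section Log.
Variable y : L.
Hypotheses (yt : N y <= t ^+ 2) (yE : lexp y = 1 + v).

Definition generator : L := q^-1 *: y.
Let a := generator.
Definition generator_op : B -> B := galg_op generator.
Let A := generator_op.

Let ya : y = q *: a. Proof. by rewrite scalerA divff// scale1r. Qed.

Lemma generator_norm : N a <= 1.
Proof.
by rewrite (unZ uN) vabsV// vq mulrC ler_pdivrMr ?mul1r ?exprn_gt0.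
Qed.

Lemma generator_bounded : bounded_op A.
Proof. exact: gen_alg_bounded (galgP a). Qed.

(** [V] is an exponential series in [A], and [A] was found inside the algebra
of [V]. *)
Lemma gen_alg_generator : gen_alg A = gen_alg V.
Proof.
have bA := generator_bounded.
apply/seteqP; split; first exact: (gen_alg_sub bV (galgP a)).
apply: (gen_alg_sub bA); apply: (gen_alg_closed bA bV) => e e0.
have [n0 H] := alg_expP uN t_gt0 t_lt1 fact_ge yt e0.
exists (galg_op (exp_sum n0 y - 1)); last first.
  have := H n0 (leqnn _); rewrite yE -(unN uN) => Hn.
  rewrite (_ : V - _ = galg_op (- (exp_sum n0 y - (1 + v)))) //.
  have -> : - (exp_sum n0 y - (1 + v)) = v - (exp_sum n0 y - 1) by ring.
  by [].
have gB (S T : L) : gen_alg A (galg_op S) -> gen_alg A (galg_op T) -> gen_alg A (galg_op (S - T)).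
  by move=> LS LT; exact: (gen_algD bA LS (gen_algN bA LT)).
have gy : gen_alg A (galg_op y) by rewrite ya; exact: (gen_algZ bA q (gen_alg_self bA)).
have gX n : gen_alg A (galg_op (y ^+ n)).
  elim: n => [|n IH]; first exact: (gen_alg_id bA).
  rewrite exprS; exact: (gen_algM bA gy IH).
apply: gB; last exact: (gen_alg_id bA).
rewrite /exp_sum; elim: n0 {H} => [|n IH].
  rewrite big_ord0; exact: (gen_alg0 bA).
rewrite big_ord_recr; exact: (gen_algD bA IH (gen_algZ bA _ (gX n))).
Qed.

(* The map [e^(pcl) - 1], which carries the spectrum of [A] to that of [V]. *)
Let scalar_exp l := pexp (q * l) - 1.

Let ql l : vabs l <= 1 -> vabs (q * l) <= t ^+ 2.
Proof. by move=> l1; rewrite vabsM vq ler_piMr// exprn_ge0// ltW. Qed.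

(** Up to the factor [q], the quotient of [V - scalar_exp l] by [A - l] is the
difference quotient of the exponential, a perturbation of [1]. *)
Lemma generator_factor l : vabs l <= 1 ->
  exists g g' : L, g * g' = 1 /\ v - (scalar_exp l)%:A = (a - l%:A) * g.
Proof.
move=> l1; have qlt := ql l1; have qlN : N (q * l)%:A <= t ^+ 2 by rewrite (un_scalar uN).
have [g E g1] := alg_exp_factor uN t_gt0 t_lt1 fact_ge yt qlN.
have [|g' gg'] := @add1_invertible R K _ N uN (g - 1); first exact: le_lt_trans g1 t_lt1.
exists (q *: g), (q^-1 *: g'); split.
  rewrite -scalerAl -scalerAr scalerA divff// scale1r.
  by rewrite -[RHS]gg' addrC subrK.
transitivity (lexp y - lexp (q * l)%:A).
  rewrite yE (alg_exp_scalar p_prime p_neq2 K_ext uN qlt) /scalar_exp scalerBl scale1r.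
  by ring.
by rewrite E -scalerAr scalerAl scalerBr -ya scalerA.
Qed.

(** For [vabs l > 1] the operator [A - l] is invertible as [A] has norm at most
[1]; for the others the unit factor of [generator_factor] decides. *)
Lemma generator_spectrum l :
  spectrum A l <-> vabs l <= 1 /\ spectrum V (scalar_exp l).
Proof.
have [l1|l1] := leP (vabs l) 1; last first.
  split=> [|[]//]; have [b ab] := unit_large generator_norm l1.
  by case; exact: galg_invertible ab.
have [g [g' [gg' vE]]] := generator_factor l1.
have -> : spectrum V (scalar_exp l) = (~ invertible_op (galg_op (v - (scalar_exp l)%:A))) by [].
rewrite vE; have H := invertible_unit_mul (a - l%:A) gg'.
by split=> [sA|[_ sV]]; [split=> // /H|move/H].
Qed.

Let scalar_exp_dist l m : vabs l <= 1 -> vabs m <= 1 ->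
  vabs (scalar_exp l - scalar_exp m) = t ^+ 2 * vabs (l - m).
Proof.
move=> l1 m1; have -> : scalar_exp l - scalar_exp m = pexp (q * l) - pexp (q * m).
  by rewrite /scalar_exp; ring.
by rewrite (pexp_isometry p_prime p_neq2 K_ext) ?ql// -mulrBr vabsM vq.
Qed.

Let scalar_exp_inj l m : vabs l <= 1 -> vabs m <= 1 -> scalar_exp l = scalar_exp m -> l = m.
Proof.
move=> l1 m1 E; apply/eqP; rewrite -subr_eq0 -(@vabs_eq0 R).
have := scalar_exp_dist l1 m1; rewrite E subrr vabs0 => /esym/eqP.
by rewrite mulf_eq0 expf_eq0 gt_eqF.
Qed.

Let scalar_exp_onto m : spectrum V m -> exists2 l, padic_int K l & scalar_exp l = m.
Proof.
move=> /specV[z zint zE]; have [Pz _] := zint.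
have Pm : padic_num K m.
  by rewrite -zE; apply: (padic_numM p_prime K_ext) => //; exact: padic_num_nat.
have mt : vabs m <= t ^+ 2 by rewrite -zE vabs_pmul.
have [x [Px xt xE]] := pexp_padic_onto p_prime p_neq2 K_ext Pm mt.
exists (q^-1 * x); last by rewrite /scalar_exp mulrA divff// mul1r xE addrC addKr.
split; last by rewrite vabsM vabsV// vq mulrC ler_pdivrMr ?mul1r ?exprn_gt0.
apply: (padic_numM p_prime K_ext) => //; apply: (padic_numV p_prime K_ext).
by apply: (padic_numM p_prime K_ext); [exact: padic_num_nat|case: c_int].
Qed.

(** A point of [spectrum V] is p-adic, so the equation [scalar_exp l = m] has a
p-adic solution, and it has only one solution in the unit ball. *)
Lemma generator_spectrum_padic : spectrum A `<=` padic_int K.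
Proof.
move=> l /generator_spectrum[l1 /scalar_exp_onto[m mint E]].
by rewrite (scalar_exp_inj l1 _ (esym E))//; case: mint.
Qed.

(** Larger scalars [l] make [A - l] invertible in the algebra. *)
Lemma generator_gelfand_le1 (x : L -> R) l : berkovich (gen_alg V) x ->
  x (a - l%:A) = 0 -> vabs l <= 1.
Proof.
move=> bx x0; rewrite leNgt; apply/negP => l1.
have [b ab] := unit_large generator_norm l1.
exact: (seminorm_unit bx ab).
Qed.

(** The canonical homeomorphism of [V] followed by the inverse of [scalar_exp]
is the one of [A]. *)
Lemma generator_strongly_normal : strongly_normal A.
Proof.
have [[_ _ chV] s0 sc sd [h [hh hval]]] := snV.
have /choice[f Hf] m : exists l, spectrum V m -> padic_int K l /\ scalar_exp l = m.
  by have [/scalar_exp_onto[l li lE]|nm] := pselect (spectrum V m); [exists l|exists 0].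
have le1 l : spectrum A l -> vabs l <= 1 by move=> /generator_spectrum[].
have ffun : set_fun (spectrum V) (spectrum A) f.
  move=> m sm; have [[_ l1] E] := Hf m sm; apply/generator_spectrum; split => //.
  by rewrite E.
have efun : set_fun (spectrum A) (spectrum V) scalar_exp by move=> l /generator_spectrum[].
have fK m : spectrum V m -> scalar_exp (f m) = m by move=> /Hf[].
have eK l : spectrum A l -> f (scalar_exp l) = l.
  move=> sl; apply: scalar_exp_inj; [exact/le1/ffun/efun|exact: le1|exact/fK/efun].
have fbij : set_bij (spectrum V) (spectrum A) f.
  split=> // [m n|l sl].
    by rewrite !inE => sm sn E; rewrite -(fK m)// -(fK n)// E.
  by exists (scalar_exp l); [exact: efun|exact: eK].
have ce : {within spectrum A, continuous scalar_exp}.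
  apply: (scaling_continuous (r := t ^+ 2)) => l m sl sm.
  by rewrite scalar_exp_dist// le1.
have cf : {within spectrum V, continuous f}.
  apply: (scaling_continuous (r := (t ^+ 2)^-1)) => m n sm sn.
  rewrite -{2}(fK m)// -{2}(fK n)// scalar_exp_dist; try exact/le1/ffun.
  by rewrite mulKf// expf_neq0// gt_eqF.
have EL := gen_alg_generator.
rewrite /strongly_normal /normal_op EL; split.
- by split => //; exact: generator_bounded.
- by have [m sm] := s0; exists (f m); exact: ffun.
- have -> : spectrum A = f @` spectrum V.
    apply/seteqP; split=> [l sl|_ [m sm <-]]; last exact: ffun.
    by exists (scalar_exp l); [exact: efun|exact: eK].
  exact: continuous_compact.
- apply: (totally_disconnected_inj efun _ ce sd) => l m.
  by rewrite !inE => sl sm; apply: scalar_exp_inj; exact: le1.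
- exists (f \o h); split.
    by apply: (homeo_on_comp hh fbij efun) => // m; rewrite inE => sm; exact: fK.
  move=> x bx /=.
  have /(gelfand_valueE (bV := bV) (nt := nt) x v) E := hval x bx.
  have sx : spectrum V (h x) by have [[hfun _ _] _ _] := hh; exact: hfun.
  have [[Pl l1] lE] := Hf _ sx; set l := f (h x) in Pl l1 lE *.
  apply/(gelfand_valueE (bV := bV) (nt := nt) x a).
  have [g [g' [gg' vE]]] := generator_factor l1.
  move: E; rewrite -lE vE (seminormM bx) => /eqP.
  by rewrite mulf_eq0 => /orP[/eqP//|/eqP /(seminorm_unit bx gg')].
Qed.

(** ** The representation *)

Variable W : K -> B -> B.
Hypotheses (W_rep : unitary_rep W) (WcE : W c = idfun + V).

Let gen_scaled z : padic_int K z -> N ((p%:R * z) *: a) <= t ^+ 2.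
Proof.
move=> zint; rewrite (unZ uN) (le_trans _ (vabs_pmul zint))//.
by rewrite ler_piMr ?vabs_ge0// generator_norm.
Qed.

Let rep_nat n : W (n.+1%:R * c) = galg_op (lexp y ^+ n.+1).
Proof.
rewrite yE; elim: n => [|n IH]; first by rewrite mul1r WcE expr1 addrC addrC.
have [_ WD _] := W_rep.
have E : n.+2%:R * c = c + n.+1%:R * c :> K by rewrite -natr1 mulrDl mul1r addrC.
rewrite E WD//; last first.
  by apply: (padic_intM p_prime K_ext) => //; exact: (padic_int_nat p_prime K_ext).
by rewrite IH WcE [in RHS]exprS.
Qed.

(** Both sides are continuous in [z], and they agree at the multiples of [c] by
positive integers, which are dense as [c] is a unit. *)
Lemma rep_generator z : padic_int K z -> W z = galg_op (lexp ((p%:R * z) *: a)).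
Proof.
move=> zint; have [WU _ Wc] := W_rep.
have bW : bounded_op (W z).
  have [Q [-> [[bQ _ _] _ _ _ _] _]] := WU z zint.
  by apply: bounded_add => //; exact: bounded_id.
set T := lexp _; have bT : bounded_op (galg_op T) by exact: gen_alg_bounded (galgP T).
have bD : bounded_op (W z - galg_op T) by exact: bounded_sub.
apply/eqP; rewrite -subr_eq0; apply/eqP/(opnorm_eq0 bD)/eqP.
rewrite eq_le opnorm_ge0// andbT; apply/ler_addgt0Pr => e e0; rewrite add0r.
have /cvgrPdist_lt/(_ e e0)/nbhs_ballP[d /= d0 Hd] := Wc z zint.
have c0 : c != 0 by rewrite -(@vabs_eq0 R) c_unit oner_eq0.
have cV : c^-1 * c = 1 by rewrite mulVf.
have zc : padic_int K (z * c^-1).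
  apply: (padic_intM p_prime K_ext) => //; split; last by rewrite vabsV// c_unit invr1.
  by apply: (padic_numV p_prime K_ext); case: c_int.
have m0 : 0 < Num.min d e by rewrite lt_min d0.
have [[//|n] _] := padic_int_dense p_prime K_ext zc m0.
have -> : n.+1%:R - z * c^-1 = (n.+1%:R * c - z) * c^-1.
  by rewrite mulrBl -mulrA (mulrC c) cV mulr1.
rewrite vabsM vabsV// c_unit invr1 mulr1 lt_min => /andP[hd he].
have nint : padic_int K (n.+1%:R * c).
  by apply: (padic_intM p_prime K_ext) => //; exact: (padic_int_nat p_prime K_ext).
have close : opnorm (W (n.+1%:R * c) - W z) < e.
  have := Hd (n.+1%:R * c) _ nint; rewrite /= ball_vabs -vabsN opprB => /(_ hd).
  by rewrite sub0r normrN; apply: le_lt_trans; exact: ler_norm.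
have WnE : W (n.+1%:R * c) = galg_op (lexp ((p%:R * (n.+1%:R * c)) *: a)).
  rewrite rep_nat -(alg_expMn uN t_gt0 t_lt1 fact_ge _ yt); congr (galg_op (lexp _)).
  by rewrite ya -scaler_nat scalerA; congr (_ *: _); rewrite /q; ring.
have bWn : bounded_op (W (n.+1%:R * c)) by rewrite WnE; exact: gen_alg_bounded (galgP _).
have -> : W z - galg_op T = (W (n.+1%:R * c) - galg_op T) - (W (n.+1%:R * c) - W z).
  by rewrite opprB [RHS]addrC subrKA.
apply: ltW; apply: opnormB_lt; try exact: bounded_sub; last exact: close.
rewrite WnE -[X in opnorm X]/(galg_op (_ - T)) -/(N _) /T.
rewrite (alg_exp_isometry uN t_gt0 t_lt1 fact_ge (gen_scaled nint) (gen_scaled zint)).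
rewrite -scalerBl (unZ uN) -mulrBr; apply: le_lt_trans he.
apply: (@le_trans _ _ (vabs (p%:R * (n.+1%:R * c - z)))).
  by rewrite ler_piMr ?vabs_ge0// generator_norm.
by rewrite vabsM ler_piMl ?vabs_ge0// (vabs_nat_le1 p_prime K_ext).
Qed.

(** The factorization of a difference of exponentials shows that the right
operator is a solution, and a second one would agree with it at all points of
the Berkovich spectrum. *)
Lemma rep_fun_calc z : padic_int K z -> W z = fun_calc A (fun l => pexp (p%:R * z * l)).
Proof.
move=> zint; rewrite /fun_calc gen_alg_generator (rep_generator zint).
set T := lexp _.
have TP (x : L -> R) l : berkovich (gen_alg V) x -> x (a - l%:A) = 0 ->
    x (T - (pexp (p%:R * z * l))%:A) = 0.
  move=> bx xl; have l1 := generator_gelfand_le1 bx xl.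
  have zlt : vabs (p%:R * z * l) <= t ^+ 2.
    by rewrite vabsM (le_trans _ (vabs_pmul zint))// ler_piMr ?vabs_ge0.
  rewrite -(alg_exp_scalar p_prime p_neq2 K_ext uN zlt).
  have zlN : N (p%:R * z * l)%:A <= t ^+ 2 by rewrite (un_scalar uN).
  have [g -> _] := alg_exp_factor uN t_gt0 t_lt1 fact_ge (gen_scaled zint) zlN.
  rewrite -(scalerA (p%:R * z) l) -scalerBr -scalerAl scalerAr.
  by rewrite (seminormM bx) xl mul0r.
apply/esym/xget_unique.
  split; first exact: galgP.
  move=> x l bx /(gelfand_valueE x a) xl; apply/(gelfand_valueE x T); exact: TP.
move=> S [LS HS]; rewrite -(galg_opK bV nt LS); congr galg_op.
apply: (berkovich_separates uniV) => x bx.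
have [_ _ _ _ [h [_ hval]]] := generator_strongly_normal.
rewrite gen_alg_generator in h hval.
have xl := hval x bx; move/(gelfand_valueE x a) : (xl) => xl'.
have /(gelfand_valueE x (galg_of bV nt LS)) Sl := HS x _ bx xl.
have Tl := TP x _ bx xl'.
set k := pexp _ in Sl Tl.
have -> : galg_of bV nt LS - T = (galg_of bV nt LS - k%:A) - (T - k%:A) by ring.
apply/eqP; rewrite eq_le (seminorm_ge0 bx) andbT.
by rewrite (le_trans (seminormB bx _ _))// Sl Tl addr0.
Qed.

End Log.
End Generator.

Theorem mainTheorem2 (R : realType) (p : nat) (p_prime : prime p) (p_neq2 : p <> 2%N)
    (K : nonArchFieldType R)
    (K_ext : forall q : rat, vabs (ratr q : K) = padic_abs R p q)
    (B : nonArchBanachType K) (W : K -> B -> B) (W_rep : unitary_rep W)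
    (W_spec : spectrum (W (p%:R^-1 * plog (1 + p%:R)) - idfun) `<=`
              [set p%:R * y | y in padic_int K]) :
  exists A : B -> B,
    [/\ strongly_normal A, spectrum A `<=` padic_int K
      & forall z : K, padic_int K z ->
          W z = fun_calc A (fun l => pexp (p%:R * z * l))].
Proof.
have [c_int c_unit] := plog_unit p_prime p_neq2 K_ext.
set c := _ * plog _ in W_spec c_int c_unit.
have [WU _ _] := W_rep; have [V [WcE snV _]] := WU c c_int.
have specV : spectrum V `<=` [set p%:R * y | y in padic_int K].
  by move: W_spec; rewrite WcE addrC addKr.
have [y yt yE] := exists_log p_prime p_neq2 K_ext snV specV.
exists (generator_op p c y); split.
- exact: generator_strongly_normal.
- exact: generator_spectrum_padic.
- by move=> z; exact: rep_fun_calc.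
Qed.
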